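(* There are finite generating sets $\mathcal{A}_n$ of $\mathrm{Aut}(F_{2^{n+2}})$ ($n\in\mathbb{N}$) such that for every $\alpha\in(\alpha_0,1)$ there is a constant $C>0$ (independent of $n$ and $\ell$) with \[ \gamma^{\mathcal{A}_n}_{\mathrm{Aut}(F_{2^{n+2}})}(\ell)\le \exp\bigl(C\ell^{\alpha}\bigr)\quad\text{for every } n\in\mathbb{N} \text{ and every integer } 0\le\ell\le\tfrac{2^n-2}{3}. \] As a consequence, for every $\beta\in(0,1-\alpha_0)$ we have \[ \omega\bigl(\mathrm{Aut}(F_{2^{n+2}})\bigr)\le\exp\bigl(2^{-\beta(n+2)}\bigr) \] for all sufficiently large $n$.
   Context: $F_m$ denotes the free group of rank $m$. The constant $\alpha_0=\log(2)/\log(2/\eta)\approx 0.7674$, where $\eta$ is the unique real root of the polynomial $x^3+x^2+x-2$. For a group $G$ with finite generating set $S$, $\gamma_G^S(\ell)$ is the number of elements of $G$ that can be represented by words of length at most $\ell$ over $S\cup S^{-1}$; $\omega(G,S)=\lim_{\ell\to\infty}\sqrt[\ell]{\gamma_G^S(\ell)}$; and $\omega(G)=\inf_S\omega(G,S)$, the infimum over all finite generating sets $S$ of $G$. *)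

(* Defs.v *)
From HB Require Import structures.
From mathcomp Require Import all_boot all_order all_algebra finmap.
From mathcomp Require Import all_classical all_reals all_analysis.
From mathcomp Require Import ring lra.

Set Implicit Arguments.
Unset Strict Implicit.
Unset Printing Implicit Defensive.

Import Order.TTheory GRing.Theory Num.Theory.
Import numFieldNormedType.Exports.

Local Open Scope classical_set_scope.
Local Open Scope ring_scope.

(* The letter (i, false) is the i-th generator, (i, true) its inverse. *)
Notation letter m := ('I_m * bool)%type.

Definition linv m (x : letter m) : letter m := (x.1, ~~ x.2).

Definition reduced m (w : seq (letter m)) : bool :=
  sorted (fun x y => y != linv x) w.

Definition lmul m (x : letter m) (w : seq (letter m)) : seq (letter m) :=
  if w is y :: w' then if y == linv x then w' else x :: w else [:: x].

(* For v reduced, the reduced form of the concatenation u ++ v. *)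
Definition wmul m (u v : seq (letter m)) : seq (letter m) :=
  foldr (@lmul m) v u.

Definition winv m (w : seq (letter m)) : seq (letter m) :=
  rev (map (@linv m) w).

Lemma linvK m : involutive (@linv m).
Proof. by case=> i b; rewrite /linv /= negbK. Qed.

Lemma reduced_lmul m (x : letter m) w : reduced w -> reduced (lmul x w).
Proof.
case: w => [|y w] //= ryw; case: eqP => [_|/eqP nyx].
  exact: path_sorted ryw.
by rewrite /reduced /= nyx.
Qed.

Lemma reduced_wmul m (u v : seq (letter m)) : reduced v -> reduced (wmul u v).
Proof. by move=> rv; elim: u => //= x u; apply: reduced_lmul. Qed.

Lemma reduced_winv m (w : seq (letter m)) : reduced w -> reduced (winv w).
Proof.
rewrite /reduced /winv rev_sorted sorted_map; apply: sub_sorted => x y /=.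
by rewrite linvK eq_sym.
Qed.

Lemma lmulK m (x : letter m) w : reduced w -> lmul x (lmul (linv x) w) = w.
Proof.
case: w => [|y w] /=; first by rewrite eqxx.
rewrite linvK; case: eqP => [->|_ _]; last by rewrite /= eqxx.
by rewrite /reduced; case: w => [|z w] //= /andP[/negPf->].
Qed.

Lemma wmul_lmul m (x : letter m) u v : reduced v ->
  wmul (lmul x u) v = lmul x (wmul u v).
Proof.
case: u => [|y u] //= rv; case: eqP => [->|] //.
by rewrite lmulK ?reduced_wmul.
Qed.

Lemma wmulA m (u v w : seq (letter m)) : reduced w ->
  wmul u (wmul v w) = wmul (wmul u v) w.
Proof. by move=> rw; elim: u => //= x u ->; rewrite wmul_lmul. Qed.

Lemma wmul_nil m (u : seq (letter m)) : reduced u -> wmul u [::] = u.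
Proof.
rewrite /reduced; elim: u => //= x u IH pu; rewrite IH ?(path_sorted pu) //.
by case: u pu {IH} => //= y u /andP[/negPf->].
Qed.

Lemma winvK m : involutive (@winv m).
Proof.
move=> w; rewrite /winv map_rev revK -map_comp.
by rewrite (eq_map (g := id)) ?map_id // => x; apply: linvK.
Qed.

Lemma wmulVl m (w v : seq (letter m)) : reduced v ->
  wmul (winv w) (wmul w v) = v.
Proof.
rewrite /winv; elim: w v => //= x w IH v rv.
rewrite rev_cons /wmul foldr_rcons -!/(wmul _ _).
by rewrite -[X in lmul _ (lmul X _)]linvK lmulK ?reduced_wmul // IH.
Qed.

(* The free group of rank m, with reduced words as elements. *)
Record free_group (m : nat) : Type :=
  FreeGroup { fg_word : seq (letter m); fg_reduced : reduced fg_word }.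

HB.instance Definition _ m := [isSub for @fg_word m].
HB.instance Definition _ m := [Countable of free_group m by <:].

Section FreeGroupInstance.
Variable m : nat.
Implicit Types u v w : free_group m.

Definition fg_one : free_group m := @FreeGroup m [::] isT.
Definition fg_mul u v : free_group m :=
  FreeGroup (reduced_wmul (fg_word u) (fg_reduced v)).
Definition fg_inv u : free_group m := FreeGroup (reduced_winv (fg_reduced u)).

Lemma fg_mulA : associative fg_mul.
Proof. by move=> u v w; apply: val_inj; apply: wmulA; apply: fg_reduced. Qed.
Lemma fg_mul1 : left_id fg_one fg_mul.
Proof. by move=> u; apply: val_inj. Qed.
Lemma fg_mulr1 : right_id fg_one fg_mul.
Proof. by move=> u; apply: val_inj; apply: wmul_nil; apply: fg_reduced. Qed.
Lemma fg_mulV : left_inverse fg_one fg_inv fg_mul.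
Proof.
move=> u; apply: val_inj => /=.
by rewrite -[X in wmul _ X](wmul_nil (fg_reduced u)) wmulVl.
Qed.
Lemma fg_mulrV : right_inverse fg_one fg_inv fg_mul.
Proof.
move=> u; rewrite -[X in fg_mul X _](_ : fg_inv (fg_inv u) = u) ?fg_mulV //.
by apply: val_inj; apply: winvK.
Qed.

HB.instance Definition _ := isGroup.Build (free_group m)
  fg_mulA fg_mul1 fg_mulr1 fg_mulV fg_mulrV.

End FreeGroupInstance.

Definition fg_gen m (i : 'I_m) : free_group m :=
  @FreeGroup m [:: (i, false)] isT.

Definition fg_lift m (G : groupType) (f : 'I_m -> G) (w : free_group m) : G :=
  (\prod_(x <- fg_word w) (if x.2 then (f x.1)^-1 else f x.1))%g.

Lemma fg_lift_gen m (G : groupType) (f : 'I_m -> G) i :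
  fg_lift f (fg_gen i) = f i.
Proof. by rewrite /fg_lift big_seq1. Qed.

Lemma fg_liftM m (G : groupType) (f : 'I_m -> G) :
  {morph fg_lift f : u v / (u * v)%g}.
Proof.
move=> [u ru] [v rv]; rewrite /fg_lift /= {ru rv}.
elim: u => [|x u IH] /=; first by rewrite big_nil mul1g.
rewrite big_cons -mulgA -IH; case: (wmul u v) => [|y w] /=.
  by rewrite big_seq1 big_nil mulg1.
case: eqP => [->|_]; last by rewrite big_cons.
by rewrite big_cons /=; case: x.2; rewrite /= ?mulKg ?mulVKg.
Qed.

Lemma fg_lift_uniq m (G : groupType) (f g : free_group m -> G) :
  {morph f : u v / (u * v)%g} -> {morph g : u v / (u * v)%g} ->
  (forall i, f (fg_gen i) = g (fg_gen i)) -> f =1 g.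
Proof.
move=> fM gM fg.
have f1 : f 1%g = 1%g by apply: (@mulgI _ (f 1%g)); rewrite -fM !mulg1.
have g1 : g 1%g = 1%g by apply: (@mulgI _ (g 1%g)); rewrite -gM !mulg1.
have fV u : f u^-1%g = (f u)^-1%g.
  by apply: (@mulgI _ (f u)); rewrite -fM !mulgV.
have gV u : g u^-1%g = (g u)^-1%g.
  by apply: (@mulgI _ (g u)); rewrite -gM !mulgV.
case=> w; elim: w => [|[i b] w IH] rw.
  by rewrite (_ : FreeGroup rw = 1%g) ?f1 ?g1 //; apply: val_inj.
have rw' : reduced w by move: rw; rewrite /reduced /= => /path_sorted.
have -> : FreeGroup rw =
    ((if b then (fg_gen i)^-1 else fg_gen i) * FreeGroup rw')%g.
  apply: val_inj; rewrite /=.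
  by case: b rw; case: w {IH} rw' => //= y w _ /andP[/negPf] ->.
by rewrite fM gM (IH rw'); case: b {rw}; rewrite ?fV ?gV fg.
Qed.

Record aut (G : groupType) : Type := Aut {
  aut_fun :> G -> G;
  autM : {morph aut_fun : x y / (x * y)%g};
  aut_bij : bijective aut_fun }.

HB.instance Definition _ (G : groupType) (f : aut G) :=
  isMultiplicative.Build G G (aut_fun f) (@autM G f).

HB.instance Definition _ (G : groupType) := gen_eqMixin (aut G).
HB.instance Definition _ (G : groupType) := gen_choiceMixin (aut G).

Section AutInstance.
Variable G : groupType.
Implicit Types f g h : aut G.

Lemma autP f g : f =1 g -> f = g.
Proof.
case: f g => [f fM fb] [g gM gb] /= /funext fg; subst g.
by rewrite (Prop_irrelevance fM gM) (Prop_irrelevance fb gb).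
Qed.

Definition aut_one : aut G :=
  @Aut G id (fun _ _ => erefl) (@inv_bij _ id (frefl _)).

Lemma aut_mul_morph f g : {morph f \o g : x y / (x * y)%g}.
Proof. by move=> x y; rewrite /= !autM. Qed.

Definition aut_mul f g : aut G :=
  Aut (@aut_mul_morph f g) (bij_comp (aut_bij f) (aut_bij g)).

Lemma aut_inv_exists f : exists g, cancel f (aut_fun g) /\ cancel g f.
Proof.
have [g fK gK] := aut_bij f.
have gM : {morph g : x y / (x * y)%g}.
  by move=> x y; rewrite -{1}(gK x) -{1}(gK y) -autM fK.
by exists (Aut gM (Bijective gK fK)).
Qed.

Definition aut_inv f : aut G := sval (cid (aut_inv_exists f)).

Lemma aut_mulA : associative aut_mul.
Proof. by move=> f g h; apply: autP. Qed.
Lemma aut_mul1 : left_id aut_one aut_mul.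
Proof. by move=> f; apply: autP. Qed.
Lemma aut_mulr1 : right_id aut_one aut_mul.
Proof. by move=> f; apply: autP. Qed.
Lemma aut_mulV : left_inverse aut_one aut_inv aut_mul.
Proof.
by move=> f; apply: autP => x; apply: (svalP (cid (aut_inv_exists f))).1.
Qed.
Lemma aut_mulrV : right_inverse aut_one aut_inv aut_mul.
Proof.
by move=> f; apply: autP => x; apply: (svalP (cid (aut_inv_exists f))).2.
Qed.

HB.instance Definition _ := isGroup.Build (aut G)
  aut_mulA aut_mul1 aut_mulr1 aut_mulV aut_mulrV.

End AutInstance.

Section Growth.
Variable G : groupType.
Implicit Types (S : {fset G}) (w : seq G) (l : nat).

Definition is_word S w : bool :=
  all (fun s => (s \in S) || ((s^-1)%g \in S)) w.

Definition generates S : Prop :=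
  forall g : G, exists2 w, is_word S w & g = (\prod_(s <- w) s)%g.

Definition word_ball S l : set G :=
  [set g | exists w,
    [/\ is_word S w, (size w <= l)%N & g = (\prod_(s <- w) s)%g]].

Lemma finite_word_ball S l : finite_set (word_ball S l).
Proof.
pose T : set G := [set` S] `|` [set (s^-1)%g | s in [set` S]].
have finT : finite_set T.
  by rewrite finite_setU; split; [|apply: finite_image]; apply: finite_fset.
elim: l => [|l IH].
  apply: (sub_finite_set _ (finite_set1 1%g)) => g [w [_]].
  by rewrite leqn0 size_eq0 => /eqP-> ->; rewrite big_nil.
apply: (sub_finite_set (B := [set 1%g] `|`
  [set (s * h)%g | s in T & h in word_ball S l])).
  move=> g [[|s w] [/= wS sw ->]]; first by left; rewrite big_nil.
  right; move/andP: wS => [sS wS]; rewrite big_cons.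
  exists s; last by exists (\prod_(x <- w) x)%g => //; exists w.
  by case/orP: sS => sS; [left | right; exists (s^-1)%g; rewrite ?invgK].
by rewrite finite_setU; split; [apply: finite_set1 | apply: finite_image2].
Qed.

Definition growth S l : nat := #|` fset_set (word_ball S l)|.

End Growth.

Section GrowthRate.
Variables (R : realType) (G : groupType).

(* The limit exists for every S, since growth S is submultiplicative. *)
Definition growth_rate (S : {fset G}) : R :=
  lim ((growth S l)%:R `^ (l%:R^-1) @[l --> \oo]).

(* The infimum is taken in \bar R, so that it is +oo (rather than the junk
   value of a real infimum) when G has no finite generating set. *)
Definition min_growth_rate : \bar R :=
  ereal_inf [set (growth_rate S)%:E | S in [set S | generates S]].

End GrowthRate.

Section Alpha0.
Variable R : realType.

Definition eta_poly : {poly R} := 'X^3 + 'X^2 + 'X - 2%:P.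

Definition eta : R := xget 0 [set x | root eta_poly x].

Lemma eta_polyE x : eta_poly.[x] = x ^+ 3 + x ^+ 2 + x - 2.
Proof. by rewrite /eta_poly !hornerE. Qed.

Lemma root_eta_poly x : root eta_poly x = (x == eta).
Proof.
have root_eta : root eta_poly eta.
  have [|y _ ry] := @poly_ivt R eta_poly 0 1 ler01.
    by rewrite !eta_polyE; apply/andP; split; lra.
  by rewrite /eta; case: xgetP => [z _ //|/(_ y)].
apply/idP/eqP => [|-> //]; move: root_eta.
rewrite /root !eta_polyE; set y := eta => /eqP ry /eqP rx.
have xy0 : (x - y) * (x ^+ 2 + x * y + y ^+ 2 + x + y + 1) = 0.
  transitivity ((x ^+ 3 + x ^+ 2 + x - 2) - (y ^+ 3 + y ^+ 2 + y - 2)).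
    by ring.
  by rewrite ry rx subrr.
have : x ^+ 2 + x * y + y ^+ 2 + x + y + 1 != 0.
  rewrite gt_eqF //.
  rewrite (_ : _ + 1 = (x + (y + 1) / 2) ^+ 2 + 3/4 * (y + 1/3) ^+ 2 + 2/3);
    last by field.
  have := sqr_ge0 (x + (y + 1) / 2); have := sqr_ge0 (y + 1/3); lra.
by move: xy0 => /eqP; rewrite mulf_eq0 subr_eq0 => /orP[/eqP|->].
Qed.

Definition alpha0 : R := ln 2 / ln (2 / eta).

End Alpha0.

(* Main.v *)
(** Let the first Grigorchuk group act on two disjoint copies of its Schreier
graph of level [n + 1], a path with [M = 2 ^ (n + 1)] vertices, and hence on the
[2 * M] generators of the free group. Besides these permutations take two
transpositions and a sign change supported near one end of each path, and a
transvection [x -> x y] where [x] and [y] are the two other ends.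

Growth. In a word of length [l] much smaller than [M] the conjugates of the
transvection stay near one pair of ends, and those of the other generators near
the other pair. The former commute with each other because the two paths are
moved in parallel, and a conjugate is determined by the place where it acts,
which lies in the inverted orbit of an end of the path. So an element is
determined by a product of Grigorchuk generators, by an integer between [-l] and
[l] at each point of an inverted orbit, and by a signed permutation supported on
three other inverted orbits. For the weights [1 - eta^3], [eta^3], [1 - eta^2],
[1 - eta] of [a], [b], [c], [d], the two sections of a word of weight [w] have
total weight at most [eta * (w + weight a)]; so the tree of iterated sections,
cut at words of bounded length, has at most [(w + 1) ^ alpha] leaves whenever
[2 * (eta / 2) ^ alpha < 1], that is, [alpha > alpha0]. This bounds both the
size of the inverted orbits and the length of a code for the Grigorchuk group
element.

Generation. The conjugates of the transpositions connect all the generators, so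
all signed permutations and all transvections are obtained, and Nielsen's
theorem applies. The bound on [omega] follows by taking [l = 2 ^ (n - 2)], as
[growth S l] is submultiplicative in [l]. *)
Require Import Defs.
From mathcomp Require Import fingroup perm.
From mathcomp Require Import all_boot all_order all_algebra finmap.
From mathcomp Require Import all_classical all_reals all_analysis.
From mathcomp Require Import ring lra zify.

Import Order.TTheory GRing.Theory Num.Theory.
Import numFieldNormedType.Exports.

Set Implicit Arguments.
Unset Strict Implicit.
Unset Printing Implicit Defensive.

(** * The Grigorchuk group acting on a path *)

Local Open Scope nat_scope.

Notation klein := (bool * bool)%type.

Definition vmul (u v : klein) : klein := (u.1 (+) v.1, u.2 (+) v.2).

(** The three nontrivial characters of the Klein four-group, with kernels generated by [d], [c] and
    [b]. *)
Definition chi (v : klein) (r : nat) : bool :=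
  match r with 0 => v.1 | 1 => v.2 | _ => v.1 (+) v.2 end.

(** The cycle [b -> c -> d -> b] of the recursion [b = (a, c)], [c = (a, d)], [d = (1, b)]. *)
Definition vshift (v : klein) : klein := (v.2, v.1 (+) v.2).

(* The generator [a] and the Klein four-group [{1, b, c, d}] of the first
   Grigorchuk group, acting on the vertices [0 .. 2 ^ k - 1] of its Schreier
   graph of level [k], and on the translates of that path by multiples of
   [2 ^ k]. In [klein], [b = (true, true)], [c = (true, false)] and
   [d = (false, true)]; whether [v] exchanges [2 j - 1] and [2 j] depends on the
   2-adic valuation of [j] modulo 3. *)
Definition act_a (k i : nat) : nat :=
  if k is 0 then i else if odd i then i.-1 else i.+1.

(** The divisibility test excludes the pairs straddling two translates of the path, so that the ends
    of each translate are fixed. *)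
Definition v_moves k (v : klein) j :=
  ~~ (2 ^ k.-1 %| j) && chi v (logn 2 j %% 3).

Definition act_v k (v : klein) (i : nat) : nat :=
  if v_moves k v (uphalf i) then if odd i then i.+1 else i.-1 else i.

Lemma chi_mul u v r : chi (vmul u v) r = chi u r (+) chi v r.
Proof. by case: u v r => [[] []] [[] []] [|[|r]]. Qed.

Lemma v_movesM k u v j :
  v_moves k (vmul u v) j = v_moves k u j (+) v_moves k v j.
Proof. by rewrite /v_moves chi_mul; case: (_ %| _). Qed.

Lemma v_moves0 k v : v_moves k v 0 = false.
Proof. by rewrite /v_moves dvdn0. Qed.

Lemma act_v0 k v : act_v k v 0 = 0.
Proof. by rewrite /act_v v_moves0. Qed.

Lemma uphalf_act_v k v i : uphalf (act_v k v i) = uphalf i.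
Proof.
rewrite /act_v; case: ifP => // mv.
have : uphalf i != 0 by apply/eqP => e; rewrite e v_moves0 in mv.
by case: ifP; lia.
Qed.

Lemma act_vM k u v i : act_v k (vmul u v) i = act_v k u (act_v k v i).
Proof.
rewrite [act_v k u _]/act_v uphalf_act_v /act_v v_movesM.
case mv: (v_moves k v _); case: (v_moves k u _) => //=.
have : uphalf i != 0 by apply/eqP => e; rewrite e v_moves0 in mv.
by case: ifP; case: ifP; lia.
Qed.

Lemma act_v1 k i : act_v k (false, false) i = i.
Proof.
rewrite /act_v /v_moves; case: (logn _ _ %% 3) => [|[|?]] /=; by rewrite andbF.
Qed.

Lemma act_vK k v : involutive (act_v k v).
Proof.
move=> i; rewrite -act_vM -[RHS](act_v1 k); congr act_v.
by case: v => [[] []].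
Qed.

Lemma act_aK k : involutive (act_a k).
Proof. by move=> i; rewrite /act_a; case: k => // k; case: ifP; case: ifP;
  lia. Qed.

(* [pack z h] is the vertex with first letter [z] below the vertex [h] of the
   previous level; this is the Gray code order along the Schreier graph. *)
Definition pack (z : bool) (h : nat) : nat := h.*2 + (odd h (+) ~~ z).

Lemma packP i : i = pack (odd i == odd i./2) i./2.
Proof. by rewrite /pack -{1}(odd_double_half i) addnC; case: (odd i);
  case: (odd _). Qed.

Lemma act_a_pack k z h : act_a k.+1 (pack z h) = pack (~~ z) h.
Proof. by rewrite /act_a /pack; case: z; case: (odd h) => /=; case: ifP;
  lia. Qed.

Lemma odd_pack z h : odd (pack z h) = odd h (+) ~~ z.
Proof. by rewrite /pack oddD odd_double; case: (odd h); case: z. Qed.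

Lemma uphalf_pack z h : uphalf (pack z h) = h + (odd h (+) ~~ z).
Proof. by rewrite /pack; case: (odd h); case: z => /=; lia. Qed.

Lemma v_moves_double k v t : v_moves k.+1 v t.*2 = v_moves k (vshift v) t.
Proof.
rewrite /v_moves /=; case: t => [|t]; first by rewrite !dvdn0.
have -> : (2 ^ k %| t.+1.*2) = (2 ^ k.-1 %| t.+1).
  case: k => [|k]; first by rewrite !dvd1n.
  by rewrite expnS -mul2n dvdn_pmul2l.
have -> : logn 2 t.+1.*2 = 1 + logn 2 t.+1 by rewrite -mul2n lognM.
rewrite -modnDmr; congr (_ && _).
have : logn 2 t.+1 %% 3 < 3 by rewrite ltn_mod.
case: v => v1 v2; rewrite /vshift.
by case: (logn 2 t.+1 %% 3) => [|[|[|//]]] //=; case: v1; case: v2.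
Qed.

Lemma v_moves_odd k v t : v_moves k.+1 v t.*2.+1 = (k != 0) && v.1.
Proof.
rewrite /v_moves /=; have -> : logn 2 t.*2.+1 = 0.
  by rewrite lognE dvdn2 /= odd_double.
case: k => [|k]; first by rewrite dvd1n.
suff -> : 2 ^ k.+1 %| t.*2.+1 = false by [].
apply/negP => /(dvdn_trans (dvdn_exp _ (dvdnn 2))) => /(_ isT).
by rewrite dvdn2 /= odd_double.
Qed.

Lemma act_v_pack_true k v h :
  act_v k.+1 v (pack true h) = pack true (act_v k (vshift v) h).
Proof.
rewrite /act_v uphalf_pack odd_pack /= !addbF.
have -> : h + odd h = (uphalf h).*2 by lia.
rewrite v_moves_double; case: ifP => // mv; rewrite /pack /=.
have : uphalf h != 0 by apply/eqP => e; rewrite e v_moves0 in mv.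
by case: ifP => oh; rewrite ?oddS ?addbF; lia.
Qed.

Lemma act_v_pack_false k v h :
  act_v k.+1 v (pack false h) = pack false (if v.1 then act_a k h else h).
Proof.
rewrite /act_v uphalf_pack odd_pack /= !addbT.
have -> : h + ~~ odd h = h./2.*2.+1 by lia.
rewrite v_moves_odd /act_a; case: k => [|k] /=; first by case: v.1.
by case: v.1 => //; rewrite /pack; case: ifP => oh; case: ifP => oh'; lia.
Qed.

Arguments act_a : simpl never.

(* The pair [(y0, [:: y1; ...; yr])] stands for [y0 a y1 a ... a yr]. *)
Notation gword := (klein * seq klein)%type.

Fixpoint gact k (y : klein) (l : seq klein) (i : nat) : nat :=
  act_v k y (if l is y' :: l' then act_a k (gact k y' l' i) else i).

(** Left multiplication by [y] seen in a section: below one letter [y] acts as [vshift y], below the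
    other as [a] or trivially. *)
Definition contrib (z : bool) (y : klein) (w : gword) : gword :=
  if z then (vmul (vshift y) w.1, w.2)
  else if y.1 then ((false, false), w.1 :: w.2) else w.

(* Indexed by the letter [z] at which the word arrives, not by the one from
   which it starts: prefixes of the word then give prefixes of the section. *)
Fixpoint section (z : bool) (y : klein) (l : seq klein) : gword :=
  contrib z y (if l is y' :: l' then section (~~ z) y' l'
               else ((false, false), [::])).

Lemma gact_vmul k u y l i : gact k (vmul u y) l i = act_v k u (gact k y l i).
Proof. by case: l => [|y' l] /=; rewrite act_vM. Qed.

Lemma gact_contrib k z y w i :
  pack z (gact k (contrib z y w).1 (contrib z y w).2 i) =
  act_v k.+1 y (pack z (gact k w.1 w.2 i)).
Proof.
case: z => /=; first by rewrite act_v_pack_true gact_vmul.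
by rewrite act_v_pack_false; case: y.1 => //=; rewrite act_v1.
Qed.

(** Each [a] flips the first letter and Klein letters preserve it, so the letter of arrival depends
    on the parity of the number of letters [a]. *)
Lemma gact_section k y l z h :
  gact k.+1 y l (pack z h) =
  pack (z (+) odd (size l))
    (gact k (section (z (+) odd (size l)) y l).1
            (section (z (+) odd (size l)) y l).2 h).
Proof.
elim: l y => [|y' l IH] y /=.
  by rewrite addbF gact_contrib /= act_v1.
by rewrite IH act_a_pack -gact_contrib addbN negbK.
Qed.

(* The inverted orbit of [0]. Only the prefixes ending in [a] matter, since
   [act_v k y 0 = 0]. *)
Fixpoint orbit_points k (y : klein) (l : seq klein) : seq nat :=
  0 :: if l is y' :: l' then
         [seq act_v k y (act_a k e) | e <- orbit_points k y' l'] else [::].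

Lemma size_orbit_points k y l : size (orbit_points k y l) = (size l).+1.
Proof. by elim: l y => //= y' l IH y; rewrite size_map IH. Qed.

Lemma mem0_orbit_points k y l : 0 \in orbit_points k y l.
Proof. by case: l => [|? ?]; rewrite inE. Qed.

Lemma orbit_points_vmul k u y l :
  orbit_points k (vmul u y) l = map (act_v k u) (orbit_points k y l).
Proof.
case: l => [|y' l] /=; rewrite act_v0 // -map_comp; congr (_ :: _).
by apply: eq_map => e /=; rewrite act_vM.
Qed.

Lemma orbit_points_contrib k z y w e : e \in orbit_points k w.1 w.2 ->
  exists2 e', e' \in orbit_points k (contrib z y w).1 (contrib z y w).2 &
    act_v k.+1 y (pack z e) = pack z e'.
Proof.
move=> ew; case: z => /=.
  exists (act_v k (vshift y) e); last by rewrite act_v_pack_true.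
  by rewrite orbit_points_vmul; apply: map_f.
rewrite act_v_pack_false; case: y.1 => /=; last by exists e.
exists (act_a k e) => //; rewrite inE; apply/orP; right; apply/mapP.
by exists e => //; rewrite act_v1.
Qed.

(** A prefix of the word gives a prefix of the section at its letter of arrival, and [0] is
    [pack true 0]; so the inverted orbits of the two sections cover that of the word. *)
Lemma orbit_points_section k y l e : e \in orbit_points k.+1 y l ->
  exists z, exists2 e',
    e' \in orbit_points k (section z y l).1 (section z y l).2 & e = pack z e'.
Proof.
elim: l y e => [|y' l IH] y e /=; rewrite !inE.
  by move=> /eqP->; exists true, 0; rewrite ?inE.
case/orP => [/eqP->|]; first by exists true, 0; rewrite ?mem0_orbit_points.
case/mapP => e1 /IH[z [e2 e2P ->]] ->.
rewrite act_a_pack; exists (~~ z); rewrite negbK.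
have [e3 ? ->] := orbit_points_contrib (~~ z) y e2P.
by exists e3.
Qed.

Lemma gact0 y l i : gact 0 y l i = i.
Proof.
by elim: l y => [|y' l IH] y /=; rewrite ?IH /act_v /v_moves dvd1n.
Qed.

(** * Weights and contraction *)

Local Open Scope ring_scope.

Section Weight.
Variables (R : realType) (e : R).
Hypotheses (e0 : 0 < e) (e1 : e < 1) (eP : e ^+ 3 + e ^+ 2 + e = 2).

Definition weight (v : klein) : R :=
  if v.1 then if v.2 then e ^+ 3 else 1 - e ^+ 2
  else if v.2 then 1 - e else 0.

Definition gweight (y : klein) (l : seq klein) : R :=
  weight y + \sum_(v <- l) (1 - e ^+ 3 + weight v).

Lemma eta_sq_lt1 : e ^+ 2 < 1.
Proof. by rewrite expr_lt1 // ltW. Qed.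

Lemma eta_cube_lt1 : e ^+ 3 < 1.
Proof. by rewrite expr_lt1 // ltW. Qed.

Lemma weight_ge0 v : 0 <= weight v.
Proof.
have h0 := e0; have h1 := e1;
have := eta_sq_lt1; have := exprn_gt0 3 e0.
by move=> ? ?; case: v => [[] []]; rewrite /weight /=; lra.
Qed.

Lemma weight_le1 v : weight v <= 1.
Proof.
have h0 := e0; have h1 := e1;
have := eta_cube_lt1; have := exprn_gt0 2 e0.
by move=> ? ?; case: v => [[] []]; rewrite /weight /=; lra.
Qed.

Lemma weight_mul u v : weight (vmul u v) <= weight u + weight v.
Proof.
have h0 := e0; have h1 := e1; have hP := eP.
have := eta_cube_lt1; have := eta_sq_lt1; have := exprn_gt0 3 e0.
by move=> ? ? ?; case: u v => [[] []] [[] []]; rewrite /weight /=; lra.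
Qed.

(* The weights were chosen so as to have equality for [y] nontrivial. *)
Lemma weight_contrib (y : klein) :
  ((y.1 : nat)%:R * (1 - e ^+ 3) + weight (vshift y) <=
    e * (1 - e ^+ 3 + weight y)).
Proof.
have h0 := e0; have h1 := e1; have hP := eP.
have e3 : e ^+ 3 = 2 - e ^+ 2 - e by lra.
have e4 : e * e ^+ 3 = 2 * e - e ^+ 3 - e ^+ 2 by rewrite {1}e3; ring.
have e4' : e * e ^+ 2 = e ^+ 3 by ring.
have ee : e * e = e ^+ 2 by ring.
have := eta_cube_lt1.
case: y => [[] []]; rewrite /weight /= => h;
  rewrite ?mul1r ?mul0r ?mulrDr ?mulrBr ?mulr1 ?e4 ?e4' ?ee; lra.
Qed.

Lemma gweight_vmul u y l : gweight (vmul u y) l <= weight u + gweight y l.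
Proof. by rewrite /gweight addrA lerD2r weight_mul. Qed.

(** Sum of [weight_contrib] over the letters. A word has one [a] fewer than it has Klein letters,
    whence the added weight of an [a]. *)
Lemma gweight_section y l :
  gweight (section false y l).1 (section false y l).2 +
  gweight (section true y l).1 (section true y l).2 <=
  e * (gweight y l + (1 - e ^+ 3)).
Proof.
have base : gweight (false, false) [::] = 0 by rewrite /gweight big_nil addr0.
have step z (x : klein) w : gweight (contrib z x w).1 (contrib z x w).2 <=
    gweight w.1 w.2 + (if z then weight (vshift x) else (x.1 : nat)%:R * (1 - e
      ^+ 3)).
  case: z => /=; first by rewrite addrC gweight_vmul.
  case: x.1 => /=; last by rewrite mul0r addr0.
  rewrite /gweight big_cons mul1r /=; rewrite [weight (_, _)]/weight /=; lra.
elim: l y => [|y' l IH] y.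
  have := weight_contrib y; have := step false y ((false, false), [::]).
  have := step true y ((false, false), [::]).
  rewrite [section _ _ _]/= [section _ _ _]/= base; set a := gweight _ _.
  set b := gweight _ _.
  by rewrite /gweight big_nil; lra.
have := weight_contrib y; have := step false y (section true y' l).
have := step true y (section false y' l).
have -> : gweight y (y' :: l) = weight y + (1 - e ^+ 3) + gweight y' l.
  by rewrite /gweight big_cons; lra.
rewrite [section false y _]/= [section true y _]/=.
rewrite ![e * (_ + _)]mulrDr; have := IH y'.
rewrite ![e * (_ + _)]mulrDr; lra.
Qed.

Lemma gweight_ge y l : (1 - e ^+ 3) * (size l)%:R <= gweight y l.
Proof.
rewrite /gweight; elim: l => [|v l IH]; rewrite ?big_nil ?big_cons /=.
  by rewrite mulr0 addr0 weight_ge0.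
by rewrite -natr1; have := weight_ge0 v; lra.
Qed.

End Weight.

(** Concavity of the power [a], read off from the convexity of the inverse power [1 / a]. *)
Lemma powR_midpoint (R : realType) (a x y : R) : 0 < a -> a < 1 -> 0 <= x ->
  0 <= y ->
  x `^ a + y `^ a <= 2 * ((x + y) / 2) `^ a.
Proof.
move=> a0 a1 x0 y0.
have ia1 : 1 <= a^-1 by rewrite invf_ge1 // ltW.
have half : 2^-1 = 1 - 2^-1 :> R by rewrite {2}(splitr 1) div1r addrK.
have h01 : 0 <= 2^-1 :> R by rewrite invr_ge0.
have h11 : 2^-1 <= 1 :> R by rewrite invf_le1 ?ler1n.
have xa t : 0 <= t -> (t `^ a) `^ a^-1 = t.
  by move=> t0; rewrite -powRrM mulfV ?gt_eqF// powRr1.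
have mema t : t `^ a \in (`[0, +oo[%classic : set R).
  by rewrite inE /= in_itv /= powR_ge0.
have := @convex_powR R a^-1 ia1 (Itv01 h01 h11) _ _ (mema x) (mema y).
rewrite convRE [X in X `^ _ <= _]convRE /= /unstable.onem -half !xa // 
  -[2^-1 * x + _]mulrDr [2^-1 * (x + y)]mulrC.
move=> h; rewrite -ler_pdivrMl // mulrDr.
have p0 : 0 <= 2^-1 * x `^ a + 2^-1 * y `^ a.
  by rewrite addr_ge0 // mulr_ge0 // powR_ge0.
have h1 : (2^-1 * x `^ a + 2^-1 * y `^ a) `^ a^-1 \is Num.nneg.
  by rewrite nnegrE powR_ge0.
have h2 : (x + y) / 2 \is Num.nneg by rewrite nnegrE divr_ge0 ?addr_ge0.
have := ge0_ler_powR (ltW a0) h1 h2 h.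
by rewrite -powRrM mulVf ?gt_eqF// powRr1.
Qed.

(** The same tree of sections serves to cover the inverted orbit and to encode the action. *)
Fixpoint leaves r0 k (y : klein) (l : seq klein) : nat :=
  if (size l <= r0)%N then 1%N else
  if k is k'.+1 then
    (leaves r0 k' (section false y l).1 (section false y l).2 +
     leaves r0 k' (section true y l).1 (section true y l).2)%N
  else 1%N.

(** Induction on the tree, with concavity for the sum over the two sections; beyond length [r0] the
    slack in the contraction hypothesis absorbs the additive constants. *)
Lemma leaves_bound (R : realType) (e a : R) :
  0 < e -> e < 1 -> e ^+ 3 + e ^+ 2 + e = 2 ->
  0 < a -> a < 1 -> 2 * (e / 2) `^ a < 1 ->
  exists r0, forall k y l,
    (leaves r0 k y l)%:R <= (gweight e y l + 1) `^ a.
Proof.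
move=> e0 e1 eP a0 a1; set q := 2 * _ => q1.
have q0 : 0 < q by rewrite mulr_gt0 // powR_gt0 // divr_gt0.
(* The slack: multiplying a weight by [lam] compensates exactly the factor [q]. *)
set lam := q `^ (- a^-1).
have lam1 : 1 < lam.
  rewrite /lam powRN -[ltLHS]invr1 ltf_pV2 ?posrE ?powR_gt0 //.
  have <- : 1 `^ a^-1 = 1 :> R by rewrite powR1.
  by rewrite gt0_ltr_powR ?nnegrE ?invr_gt0 // ltW.
have lamq : q * lam `^ a = 1.
  by rewrite -powRrM mulNr mulVf ?gt_eqF // powR_inv1 ?ltW // mulfV ?gt_eqF.
have A0 : 0 < 1 - e ^+ 3 by rewrite subr_gt0 eta_cube_lt1.
have l10 : 0 < lam - 1 by rewrite subr_gt0.
(* The additive constants, divided by [e]: the weight of [a] in [gweight_section] and the shifts by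
   [1] of the two sections. *)
set c := 1 - e ^+ 3 + 2 / e.
have c0 : 0 <= c by rewrite addr_ge0 ?divr_ge0 // ltW.
have p1 : 1 = 1 `^ a :> R by rewrite powR1.
have gw0 y l : 0 <= gweight e y l.
  by apply: le_trans (gweight_ge e0 e1 y l); rewrite mulr_ge0 // ltW.
have F1 y l : 1 <= (gweight e y l + 1) `^ a.
  rewrite [leLHS]p1 ge0_ler_powR //; first exact: ltW.
  - by rewrite nnegrE.
  - by rewrite nnegrE addr_ge0.
  - by rewrite lerDr.
have [r0 r0P] : exists r0 : nat, c <= (lam - 1) * (1 - e ^+ 3) * r0%:R.
  exists (Num.bound (c / ((lam - 1) * (1 - e ^+ 3)))).
  rewrite mulrC -ler_pdivrMr ?mulr_gt0 //.
  by apply/ltW/archi_boundP; rewrite divr_ge0 // ltW // mulr_gt0.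
exists r0; elim=> [|k IH] y l /=.
  by rewrite if_same.
case: ifP => [//|/negbT].
rewrite -ltnNge => r0l; rewrite natrD.
apply: le_trans (lerD (IH _ _) (IH _ _)) _.
set x := gweight _ _ _; set z := gweight _ _ _; set W := gweight _ _ _.
have x0 : 0 <= x by exact: gw0. have z0 : 0 <= z by exact: gw0.
have W0 : 0 <= W by exact: gw0.
have xz : x + z <= e * (W + (1 - e ^+ 3)) by exact: gweight_section.
have WA : c <= (lam - 1) * W.
  apply: le_trans r0P _; rewrite -mulrA ler_pM2l //.
  apply: le_trans (gweight_ge e0 e1 y l); rewrite ler_pM2l // ler_nat ltnW //.
clearbody x z W.
apply: le_trans (powR_midpoint a0 a1 (addr_ge0 x0 ler01) (addr_ge0 z0 ler01)) _.
have -> : (W + 1) `^ a = q * (lam * (W + 1)) `^ a.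
  by rewrite powRM ?addr_ge0 // ?(ltW (lt_trans _ lam1)) // mulrA lamq mul1r.
have lam0 : 0 <= lam by rewrite ltW // (lt_trans _ lam1).
have e2 : 0 <= e / 2 by rewrite divr_ge0 // ltW.
have lamW : 0 <= lam * (W + 1) by rewrite mulr_ge0 //; lra.
rewrite /q -mulrA ler_pM2l // -powRM //.
apply: ge0_ler_powR; rewrite ?nnegrE.
- exact: ltW.
- by rewrite divr_ge0 //; lra.
- by rewrite mulr_ge0.
have -> : (x + 1 + (z + 1)) / 2 = e / 2 * ((x + z + 2) / e).
  by field; rewrite gt_eqF.
rewrite ler_wpM2l // ler_pdivrMr //.
apply: (@le_trans _ _ (e * (W + c))).
  rewrite /c mulrDr mulrDr mulrDr mulrCA mulfV ?gt_eqF //.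
  by move: xz; rewrite mulrDr; lra.
rewrite mulrC ler_pM2r //.
by have := WA; rewrite mulrBl mul1r mulrDr mulr1; have := lam1; lra.
Qed.

Local Open Scope nat_scope.

(** A leaf contributes at most [r0 + 1] points by its length, or the point [0] alone at level
    [0]. *)
Lemma orbit_points_cover r0 k y l : exists2 t : seq nat,
  size t <= r0.+1 * leaves r0 k y l & {subset orbit_points k y l <= t}.
Proof.
elim: k y l => [|k IH] y l /=.
  exists [:: 0]; first by rewrite if_same muln1.
  elim: l y => [|v l IHl] y x //=; rewrite inE => /predU1P[->|];
    rewrite ?inE //.
  case/mapP=> z /IHl /[!inE] /eqP -> ->.
  by rewrite /act_v /v_moves dvd1n.
case: ifP => [lr|_].
  by exists (orbit_points k.+1 y l); rewrite // size_orbit_points muln1.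
have [t0 s0 t0P] := IH (section false y l).1 (section false y l).2.
have [t1 s1 t1P] := IH (section true y l).1 (section true y l).2.
exists (map (pack false) t0 ++ map (pack true) t1).
  by rewrite size_cat !size_map mulnDr leq_add.
move=> x /orbit_points_section[[] [x' x'P ->]]; rewrite mem_cat.
  by apply/orP; right; apply/map_f/t1P.
by apply/orP; left; apply/map_f/t0P.
Qed.

(** Here [c] is the parity of the number of letters [a]; thus [z] is the letter of arrival, which
    selects the section. *)
Definition node_act (c : bool) (g0 g1 : nat -> nat) (i : nat) : nat :=
  let z := (odd i == odd i./2) (+) c in pack z ((if z then g1 else g0) i./2).

(* Decodes the prefix order listing of a tree of sections, and returns the
   action of the root with the unread part of the code. *)
Fixpoint decode_act r0 k (s : seq (klein * r0.-bseq klein + bool)) :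
    (nat -> nat) * seq (klein * r0.-bseq klein + bool) :=
  match s with
  | inl yl :: s' => (gact k yl.1 yl.2, s')
  | inr c :: s' =>
      if k is k'.+1 then
        let gs0 := decode_act k' s' in
        let gs1 := decode_act k' gs0.2 in
        (node_act c gs0.1 gs1.1, gs1.2)
      else (id, s')
  | [::] => (id, [::])
  end.

Lemma decode_leaf r0 k y (l : seq klein) : size l <= r0 ->
  exists b : r0.-bseq klein, forall s,
    (decode_act k (inl (y, b) :: s)) = (gact k y l, s).
Proof. by move=> lr; exists (Bseq lr) => s; case: k. Qed.

(** A binary tree with [L] leaves has [2 * L - 1] nodes. The arbitrary suffix [s'] lets the codes of
    two subtrees be concatenated. *)
Lemma decode_gact r0 k y l : exists2 s : seq (klein * r0.-bseq klein + bool),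
  size s < 2 * leaves r0 k y l &
  forall s', (decode_act k (s ++ s')).1 =1 gact k y l /\
    (decode_act k (s ++ s')).2 = s'.
Proof.
elim: k y l => [|k IH] y l.
  (* At level [0] every word acts trivially, so any leaf will do, however long [l] is. *)
  exists [:: inl (y, [bseq])] => [|s'] /=; first by rewrite if_same.
  by split=> // i; rewrite [RHS]gact0; apply: (gact0 y [::]).
case: (leqP (size l) r0) => lr.
  have [b bP] := decode_leaf k.+1 y lr.
  exists [:: inl (y, b)]; first by rewrite /= lr.
  by move=> s'; rewrite cat1s bP.
have [s0 ss0 s0P] := IH (section false y l).1 (section false y l).2.
have [s1 ss1 s1P] := IH (section true y l).1 (section true y l).2.
exists (inr (odd (size l)) :: s0 ++ s1) => [|s'] /=.
  by rewrite (leqNgt (size l)) lr /= size_cat mulnDr; lia.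
rewrite -catA; have [e0 ->] := s0P (s1 ++ s'); have [e1 ->] := s1P s'.
split=> // i; rewrite [in RHS](packP i) gact_section /node_act.
by case: (_ (+) _); rewrite ?e0 ?e1.
Qed.

Lemma decode_tuple r0 k y l L : leaves r0 k y l <= L ->
  exists t : (2 * L).-tuple (klein * r0.-bseq klein + bool),
    (decode_act k t).1 =1 gact k y l.
Proof.
move=> lL; have [s ss sP] := decode_gact r0 k y l.
have sz : size (s ++ nseq (2 * L - size s) (inr false)) == 2 * L.
  by rewrite size_cat size_nseq; lia.
by exists (Tuple sz); case: (sP (nseq (2 * L - size s) (inr false))).
Qed.

(** * Words in the Grigorchuk generators and their inverted orbits *)

Definition step k (s : option klein) : nat -> nat :=
  if s is Some v then act_v k v else act_a k.

Definition path_act k (w : seq (option klein)) (i : nat) : nat :=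
  foldr (step k) i w.

Definition normal_cons (s : option klein) (w : gword) : gword :=
  if s is Some v then (vmul v w.1, w.2) else ((false, false), w.1 :: w.2).

Definition normal_form (w : seq (option klein)) : gword :=
  foldr normal_cons ((false, false), [::]) w.

Lemma gact_normal_form k w :
  gact k (normal_form w).1 (normal_form w).2 =1 path_act k w.
Proof.
move=> i; elim: w => [|[v|] w IH] /=; first by rewrite act_v1.
  by rewrite gact_vmul IH.
by rewrite act_v1 IH.
Qed.

Fixpoint prefix_points k p (w : seq (option klein)) : seq nat :=
  p :: if w is s :: w' then map (step k s) (prefix_points k p w') else [::].

Lemma prefix_points0 k w :
  {subset prefix_points k 0 w <=
     orbit_points k (normal_form w).1 (normal_form w).2}.
Proof.
elim: w => [|s w IH] x //=; rewrite inE => /predU1P[->|].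
  by rewrite mem0_orbit_points.
case/mapP => y /IH yP ->; case: s => [v|] /=.
  by rewrite orbit_points_vmul map_f.
by rewrite inE; apply/orP; right; apply/mapP; exists y; rewrite ?act_v1.
Qed.

(* The detours [a a] make the points [u (a 0)], for [u] a prefix of [w], part of
   the inverted orbit of [0]. *)
Fixpoint interleave (w : seq (option klein)) : seq (option klein) :=
  if w is s :: w' then [:: None, None, s & interleave w'] else [:: None].

Lemma size_interleave w : size (interleave w) = (3 * size w).+1.
Proof. by elim: w => //= s w ->; lia. Qed.

Lemma prefix_points_interleave k w :
  {subset prefix_points k 0 w <= prefix_points k 0 (interleave w)} /\
  {subset prefix_points k (act_a k 0) w <= prefix_points k 0 (interleave w)}.
Proof.
elim: w => [|s w [IH1 IH2]]; first by split=> x; rewrite !inE => ->;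
  rewrite ?orbT.
have inI x : x \in prefix_points k 0 (interleave w) ->
    step k s x \in prefix_points k 0 (interleave (s :: w)).
  by move=> xw; rewrite /= !inE -[step k s x](act_aK k) !map_f ?orbT.
split=> x; rewrite [prefix_points _ _ (s :: w)]/= inE => /predU1P[->|].
- by rewrite inE eqxx.
- by case/mapP=> y /IH1 /inI yP ->.
- by rewrite /= !inE eqxx orbT.
- by case/mapP=> y /IH2 /inI yP ->.
Qed.

Lemma prefix_points_cover r0 k w : exists2 t : seq nat,
  size t <= r0.+1 * leaves r0 k (normal_form (interleave w)).1
                                (normal_form (interleave w)).2 &
  {subset prefix_points k 0 w <= t} /\
  {subset prefix_points k (act_a k 0) w <= t}.
Proof.
have [t st tP] := orbit_points_cover r0 k (normal_form (interleave w)).1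
                                          (normal_form (interleave w)).2.
have [i1 i2] := prefix_points_interleave k w.
by exists t => //; split=> x; [move/i1|move/i2]; move/prefix_points0/tP.
Qed.

Section NormalFormWeight.
Local Open Scope ring_scope.

Lemma gweight_normal_form (R : realType) (e : R) w :
  0 < e -> e < 1 -> e ^+ 3 + e ^+ 2 + e = 2 ->
  gweight e (normal_form w).1 (normal_form w).2 <= (size w)%:R.
Proof.
move=> e0 e1 eP; elim: w => [|[v|] w IH] /=.
- by rewrite /gweight big_nil /weight /= addr0.
- apply: le_trans (gweight_vmul e0 e1 eP _ _ _) _.
  by rewrite -natr1 addrC lerD // weight_le1.
- have -> : gweight e (false, false) ((normal_form w).1 :: (normal_form w).2) =
     1 - e ^+ 3 + gweight e (normal_form w).1 (normal_form w).2.
    by rewrite /gweight big_cons /weight /=; lra.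
  by rewrite -natr1; have := exprn_gt0 3 e0; lra.
Qed.

End NormalFormWeight.

(** * Nielsen's theorem *)

Local Open Scope nat_scope.

Arguments reduced : simpl never.

Section Words.
Variable m : nat.
Implicit Types (x y z : letter m) (u v w p q : seq (letter m)).

Lemma reduced_cons2 x y w :
  reduced [:: x, y & w] = (y != linv x) && reduced (y :: w).
Proof. by []. Qed.

Lemma reduced_behead x w : reduced (x :: w) -> reduced w.
Proof. by rewrite /reduced => /path_sorted. Qed.

Lemma reduced_cat u v : reduced (u ++ v) -> reduced u /\ reduced v.
Proof.
elim: u => [|x u IH] //=; case: u IH => [|y u] IH /=.
  by move=> /reduced_behead rv; split.
by rewrite reduced_cons2 => /andP[xy /IH[ru rv]]; rewrite reduced_cons2 xy.
Qed.

Lemma wmul_reduced_cat u v : reduced (u ++ v) -> wmul u v = u ++ v.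
Proof.
elim: u => //= x u IH r; rewrite IH ?(reduced_behead r) //.
move: u r {IH} => [|y u] r; last first.
  by move: r; rewrite /= reduced_cons2 => /andP[/negPf ->].
by move: v r => [|y v] //=; rewrite reduced_cons2 => /andP[/negPf ->].
Qed.

Lemma linv_neq x : linv x != x.
Proof. by case: x => i []; rewrite /linv /= xpair_eqE eqxx. Qed.

Lemma size_winv w : size (winv w) = size w.
Proof. by rewrite size_rev size_map. Qed.

Lemma winv_cat u v : winv (u ++ v) = winv v ++ winv u.
Proof. by rewrite /winv map_cat rev_cat. Qed.

Lemma winv_rcons u x : winv (rcons u x) = linv x :: winv u.
Proof. by rewrite -cats1 winv_cat. Qed.

Fixpoint lcp (s t : seq (letter m)) : nat :=
  match s, t with
  | x :: s', y :: t' => if x == y then (lcp s' t').+1 else 0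
  | _, _ => 0
  end.

Lemma lcp_size s t : lcp s t <= size s /\ lcp s t <= size t.
Proof.
elim: s t => [|x s IH] [|y t] //=; case: ifP => // _.
by case: (IH t) => *; split; rewrite ltnS.
Qed.

Lemma take_lcp s t : take (lcp s t) s = take (lcp s t) t.
Proof.
elim: s t => [|x s IH] [|y t] //=; case: eqP => // -> /=.
by rewrite IH.
Qed.

Lemma lcp_take_cat s t n q : lcp s t < n -> n <= size t ->
  lcp s (take n t ++ q) = lcp s t.
Proof.
elim: s t n => [|x s IH] [|y t] [|n] //=.
by case: eqP => // _; rewrite !ltnS => h1 h2; rewrite IH.
Qed.

Definition canc u v : nat := lcp (winv u) v.

Lemma wmul_canc u v : reduced u -> reduced v ->
  wmul u v = take (size u - canc u v) u ++ drop (canc u v) v.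
Proof.
rewrite /canc; elim/last_ind: u v => [|u x IH] v ru rv.
  by case: v rv.
have ru' : reduced u by move: ru; rewrite -cats1 => /reduced_cat[].
rewrite winv_rcons size_rcons {1}/wmul foldr_rcons -/(wmul _ _).
case: v rv => [|y v] rv /=.
  rewrite subn0 take_oversize ?size_rcons // cats0.
  by rewrite wmul_reduced_cat cats1.
rewrite eq_sym; case: eqP => [_|/eqP xy] /=.
  rewrite subSS IH ?(reduced_behead rv) // -cats1 take_cat.
  case: ltnP => //; have := leq_subr (lcp (winv u) v) (size u) => a b.
  have -> : size u - lcp (winv u) v = size u by lia.
  by rewrite subnn take0 take_size cats0.
rewrite subn0 take_oversize ?size_rcons // cat_rcons.
rewrite wmul_reduced_cat // -cat_rcons.
elim: u ru {IH ru'} => [|a u IH] /=.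
  by rewrite reduced_cons2 eq_sym xy.
case: u IH => [|b u] IH; first by rewrite /= !reduced_cons2 => /andP[-> _] /=;
  rewrite eq_sym xy.
by rewrite !reduced_cons2 => /andP[-> /IH].
Qed.

Lemma size_wmul u v : reduced u -> reduced v ->
  size (wmul u v) + 2 * canc u v = size u + size v.
Proof.
move=> ru rv; rewrite wmul_canc // size_cat size_takel ?leq_subr // size_drop.
have [] := lcp_size (winv u) v; rewrite size_winv -/(canc u v); lia.
Qed.

Lemma canc_split u v : reduced u ->
  u = take (size u - canc u v) u ++ winv (take (canc u v) v).
Proof.
move=> ru; rewrite -{1}(cat_take_drop (size u - canc u v) u); congr (_ ++ _).
rewrite -take_lcp -/(canc u v).
have cu : canc u v <= size u by rewrite -size_winv; case: (lcp_size (winv u) v).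
have -> : winv u = winv (drop (size u - canc u v) u) ++
                   winv (take (size u - canc u v) u).
  by rewrite -winv_cat cat_take_drop.
rewrite take_size_cat.
  by rewrite winvK.
by rewrite size_winv size_drop subKn.
Qed.

Lemma reduced_winv_cat p : reduced (p ++ winv p) -> p = [::].
Proof.
elim/last_ind: p => // p x _;
  rewrite winv_rcons -cats1 -catA => /reduced_cat[_].
by rewrite /= reduced_cons2 eqxx.
Qed.

(** If at least half of [u] cancelled in [u u], the middle letter of [u] would be its own inverse,
    or its two middle letters mutually inverse. *)
Lemma canc_self u : reduced u -> u != [::] -> 2 * canc u u < size u.
Proof.
move=> ru u0; rewrite ltnNge; apply/negP => h.
have cu : canc u u <= size u by case: (lcp_size (winv u) u).
have hu i : i < canc u u ->
  forall x, nth x u i = linv (nth x u (size u - i.+1)).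
  move=> ic x; have i_u : i < size u by apply: leq_trans cu.
  rewrite -(nth_take x ic) -take_lcp nth_take // /winv.
  by rewrite nth_rev size_map // (nth_map x) //; lia.
case: (posnP (size u)) => [/size0nil ue|su]; first by rewrite ue in u0.
have x : letter m by case: (u) u0.
have [ou|eu] := boolP (odd (size u)).
  have hc : (size u)./2 < canc u u by lia.
  have := hu _ hc x; have -> : size u - (size u)./2.+1 = (size u)./2 by lia.
  by move/esym/eqP; rewrite (negPf (linv_neq _)).
have hc : (size u)./2.-1 < canc u u by lia.
have := hu _ hc x.
have -> : size u - (size u)./2.-1.+1 = (size u)./2.-1.+1 by lia.
move=> E; have := ru; rewrite /reduced => /(sortedP x) /(_ (size u)./2.-1) H.
have : nth x u (size u)./2.-1.+1 != linv (nth x u (size u)./2.-1).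
  by apply: H; lia.
by rewrite E linvK eqxx.
Qed.

End Words.

(** * Nielsen reduced families of words *)

Section NielsenReduced.
Variables (m : nat) (Y : letter m -> seq (letter m)).
Implicit Types (x y z : letter m) (w : seq (letter m)).
Hypothesis Y_reduced : forall x, reduced (Y x).
Hypothesis Y_nonempty : forall x, 0 < size (Y x).
Hypothesis Y_canc : forall x y, y != linv x ->
  2 * canc (Y x) (Y y) <= size (Y x) /\ 2 * canc (Y x) (Y y) <= size (Y y).
Hypothesis Y_canc2 : forall x y z, y != linv x -> z != linv y ->
  canc (Y x) (Y y) + canc (Y y) (Y z) < size (Y y).

Definition word_image w := foldr (fun x p => wmul (Y x) p) [::] w.

Lemma reduced_word_image w : reduced (word_image w).
Proof. by elim: w => //= x w; apply: reduced_wmul. Qed.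

Definition canc_head x w := if w is y :: _ then canc (Y x) (Y y) else 0.

(** What remains of [Y y] after cancellation with its right neighbour is longer than what [Y x]
    cancels, so cancellation with [Y x] never reaches beyond [Y y]. *)
Lemma word_image_prefix x w : reduced (x :: w) ->
  (exists q, word_image (x :: w) =
    take (size (Y x) - canc_head x w) (Y x) ++ q) /\
  size (Y x) - canc_head x w + size w <= size (word_image (x :: w)).
Proof.
elim: w x => [|y w IH] x r.
  rewrite /= subn0 take_size addn0 wmul_nil //; split=> //.
  by exists [::]; rewrite cats0.
move: (r); rewrite reduced_cons2 => /andP[xy ryw].
have [[q E] sz] := IH y ryw.
have cy : canc (Y x) (Y y) < size (Y y) - canc_head y w.
  case: w ryw {IH E sz r} => [|z w] /=.
    by rewrite subn0; have := Y_nonempty y; case: (Y_canc xy) => _; lia.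
  by rewrite reduced_cons2 => /andP[yz _]; have := Y_canc2 xy yz; lia.
have cE : canc (Y x) (word_image (y :: w)) = canc (Y x) (Y y).
  by rewrite E /canc lcp_take_cat // leq_subr.
have -> : word_image [:: x, y & w] = wmul (Y x) (word_image (y :: w)) by [].
rewrite wmul_canc ?reduced_word_image // cE /=.
split; first by eexists.
rewrite size_cat size_takel ?leq_subr // size_drop.
move: sz cy => /=; lia.
Qed.

Lemma size_word_image w : reduced w -> size w <= size (word_image w).
Proof.
case: w => // x w r; have [_] := word_image_prefix r; apply: leq_trans.
have : canc_head x w < size (Y x); last by move=> /=; lia.
case: w r => [|y w] //=; rewrite reduced_cons2 => /andP[xy _].
by have := Y_nonempty x; case: (Y_canc xy); lia.
Qed.

End NielsenReduced.

(** * An ordering of words *)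

Section WordValue.
Variable m : nat.
Implicit Types (u v w p q : seq (letter m)).
Let B := #|{: letter m}|.

(* On words of equal length this is the lexicographic order. *)
Fixpoint wval w : nat :=
  if w is x :: w' then enum_rank x * B ^ size w' + wval w' else 0.

Lemma wval_lt w : wval w < B ^ size w.
Proof.
elim: w => [|x w IH] //=; rewrite expnS.
have : (enum_rank x).+1 * B ^ size w <= B * B ^ size w.
  by rewrite leq_mul2r ltn_ord orbT.
by apply: leq_trans; rewrite mulSn addnC ltn_add2r.
Qed.

Lemma wval_cat u v : wval (u ++ v) = wval u * B ^ size v + wval v.
Proof.
by elim: u => //= x u ->; rewrite size_cat expnD mulnDl mulnA addnA.
Qed.

Lemma wval_inj u v : size u = size v -> wval u = wval v -> u = v.
Proof.
elim: u v => [|x u IH] [|y v] //= [suv] E.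
have := wval_lt u; have := wval_lt v; rewrite -suv => hv hu.
have xy : (enum_rank x : nat) = enum_rank y.
  have B0 : 0 < B ^ size u by apply: leq_ltn_trans hu.
  have := congr1 (divn^~ (B ^ size u)) E.
  by rewrite -suv !divnMDl // !divn_small // !addn0.
have -> : x = y by apply/enum_rank_inj/val_inj.
by congr (_ :: _); apply: IH => //; move: E; rewrite xy -suv => /addnI.
Qed.

(** Invariant under inversion, so that a generator may be replaced by its inverse in the sums
    below. *)
Definition wval2 w := wval w + wval (winv w).

Lemma wval2_winv w : wval2 (winv w) = wval2 w.
Proof. by rewrite /wval2 winvK addnC. Qed.

(** In the inverse word [q] holds the leading digits, where the drop is at least [B ^ size u]; this
    outweighs the final [winv q] of the word itself, of value below [B ^ size u]. *)
Lemma wval2_lt u p q : size p = size q -> size p <= size u ->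
  wval q < wval p -> wval2 (u ++ winv q) < wval2 (u ++ winv p).
Proof.
move=> spq pu qp; rewrite /wval2 !winv_cat !winvK !wval_cat !size_winv spq.
have hq : wval (winv q) < B ^ size u.
  apply: leq_trans (wval_lt _) _; rewrite size_winv -spq.
  rewrite leq_pexp2l //; case: (p) qp => // x _ _.
  by apply/card_gt0P; exists x.
have hp : (wval q).+1 * B ^ size u <= wval p * B ^ size u.
  by rewrite leq_mul2r qp orbT.
move: hp; rewrite mulSn; move: hq; move: (B ^ size u) (wval p * _) (wval q * _).
move: (wval u * _) => a b c d; lia.
Qed.

End WordValue.

Definition fg_letter m (x : letter m) : free_group m := @FreeGroup m [:: x] isT.

Lemma aut1g (G : groupType) (f : aut G) : f 1%g = 1%g.
Proof. by apply: (@mulgI _ (f 1%g)); rewrite -autM !mulg1. Qed.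

Lemma autVg (G : groupType) (f : aut G) x : (f x^-1 = (f x)^-1)%g.
Proof. by apply: (@mulgI _ (f x)); rewrite -autM !mulgV aut1g. Qed.

Lemma letter_eq m (x y : letter m) : x.1 = y.1 -> y != linv x -> x = y.
Proof.
case: x y => [i b] [j c] /= ->; rewrite /linv /= xpair_eqE eqxx /= => bc.
by congr (_, _); case: b c bc => [] [].
Qed.

(** * Transvections and minimal automorphisms *)

Section AutWord.
Variable m : nat.
Implicit Types (f g t : aut (free_group m)) (x y z : letter m).

Definition aut_word f x : seq (letter m) := fg_word (f (fg_letter x)).

Lemma fg_letter_linv x : fg_letter (linv x) = ((fg_letter x)^-1)%g.
Proof. exact: val_inj. Qed.

Lemma reduced_aut_word f x : reduced (aut_word f x).
Proof. exact: fg_reduced. Qed.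

Lemma aut_word_linv f x : aut_word f (linv x) = winv (aut_word f x).
Proof. by rewrite /aut_word fg_letter_linv autVg. Qed.

Lemma aut_word_nonempty f x : 0 < size (aut_word f x).
Proof.
rewrite lt0n; apply/eqP => /size0nil e.
have : f (fg_letter x) = f 1%g by apply: val_inj;
  rewrite /= -/(aut_word f x) e aut1g.
by move/(bij_inj (aut_bij f))/(congr1 (@fg_word m)).
Qed.

Lemma aut_wordP f w (rw : reduced w) :
  fg_word (f (FreeGroup rw)) = word_image (aut_word f) w.
Proof.
elim: w rw => [|x w IH] rw /=.
  by rewrite (_ : FreeGroup rw = 1%g) ?aut1g //; apply: val_inj.
have rw' := reduced_behead rw.
have -> : FreeGroup rw = (fg_letter x * FreeGroup rw')%g.
  by apply: val_inj; rewrite /= -[RHS]/(wmul [:: x] w) wmul_reduced_cat.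
by rewrite autM -IH.
Qed.

Lemma sum_aut_word (F : seq (letter m) -> nat) f x :
  (forall w, F (winv w) = F w) ->
  \sum_i F (aut_word f (i, false)) =
  F (aut_word f x) + \sum_(i | i != x.1) F (aut_word f (i, false)).
Proof.
move=> FV; rewrite (bigD1 x.1) //=; congr (_ + _).
case: x => i [] //=; have -> : (i, true) = linv (i, false) by [].
by rewrite aut_word_linv FV.
Qed.

Definition transvection t x y :=
  t (fg_letter x) = (fg_letter x * fg_letter y)%g /\
  forall i, i != x.1 -> t (fg_gen i) = fg_gen i.

Lemma sum_aut_word_transvection (F : seq (letter m) -> nat) f t x y :
  (forall w, F (winv w) = F w) -> transvection t x y ->
  (\sum_i F (aut_word (f * t)%g (i, false))) + F (aut_word f x) =
  (\sum_i F (aut_word f (i, false))) +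
    F (wmul (aut_word f x) (aut_word f y)).
Proof.
move=> FV [tx ti]; rewrite !(@sum_aut_word _ _ x) //.
have -> : aut_word (f * t)%g x = wmul (aut_word f x) (aut_word f y).
  by rewrite /aut_word /= tx autM.
have -> : \sum_(i | i != x.1) F (aut_word (f * t)%g (i, false)) =
          \sum_(i | i != x.1) F (aut_word f (i, false)).
  by apply: eq_bigr => i ix; rewrite /aut_word /= -[fg_letter _]/(fg_gen i) ti.
lia.
Qed.

(** Cancellation is determined by the length of the product, which inversion preserves. *)
Lemma canc_winv u v : reduced u -> reduced v ->
  canc (@winv m v) (winv u) = canc u v.
Proof.
move=> ru rv; have := size_wmul ru rv.
have := size_wmul (reduced_winv rv) (reduced_winv ru).
have -> : wmul (winv v) (winv u) = winv (wmul u v).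
  have := congr1 (@fg_word m) (invgM (FreeGroup ru) (FreeGroup rv)).
  by move=> /= <-.
rewrite !size_winv; lia.
Qed.

Definition aut_length f := \sum_i size (aut_word f (i, false)).
Definition aut_value f := \sum_i wval2 (aut_word f (i, false)).

Definition nielsen_minimal f := forall t x y, x.1 != y.1 ->
  transvection t x y ->
  aut_length f <= aut_length (f * t)%g /\
  (aut_length (f * t)%g = aut_length f -> aut_value f <= aut_value (f * t)%g).

Hypothesis transvection_exists : forall x y, x.1 != y.1 ->
  exists t, transvection t x y.

Section Minimal.
Variable f : aut (free_group m).
Hypothesis f_min : nielsen_minimal f.
Let Y := aut_word f.

(** If more than half of [Y y] cancelled, replacing [Y x] by the product would shorten the images;
    the case [y = x] is [canc_self]. *)
Lemma minimal_canc_r x y : y != linv x -> 2 * canc (Y x) (Y y) <= size (Y y).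
Proof.
move=> xy; have rx := reduced_aut_word f x; have ry := reduced_aut_word f y.
have [xy1|xy1] := eqVneq x.1 y.1.
  have <- := letter_eq xy1 xy.
  by rewrite ltnW // canc_self // -size_eq0 -lt0n aut_word_nonempty.
have [t tP] := transvection_exists xy1.
have [h _] := f_min xy1 tP.
have := sum_aut_word_transvection f (@size_winv m) tP.
have := size_wmul rx ry;
  rewrite -/(aut_length _) -/(aut_length _) -/(Y x) -/(Y y).
lia.
Qed.

Lemma minimal_canc x y : y != linv x ->
  2 * canc (Y x) (Y y) <= size (Y x) /\ 2 * canc (Y x) (Y y) <= size (Y y).
Proof.
move=> xy; split; last exact: minimal_canc_r.
have yx : linv x != linv (linv y) by rewrite linvK eq_sym.
have := minimal_canc_r yx.
by rewrite /Y !aut_word_linv canc_winv ?reduced_aut_word // size_winv.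
Qed.

(* A letter entirely absorbed by its two neighbours is [p q^-1] with [p] and
   [q] of the same length; depending on which is smaller, one of the two
   transvections replaces a neighbour by one of the same length and of
   smaller value. *)
Lemma minimal_canc2 x y z : y != linv x -> z != linv y ->
  canc (Y x) (Y y) + canc (Y y) (Y z) < size (Y y).
Proof.
move=> xy yz; rewrite ltnNge; apply/negP => h.
have [cx1 cx2] := minimal_canc xy; have [cz1 cz2] := minimal_canc yz.
have rx : reduced (Y x) := reduced_aut_word f x.
have ry : reduced (Y y) := reduced_aut_word f y.
have rz : reduced (Y z) := reduced_aut_word f z.
have ny : 0 < size (Y y) := aut_word_nonempty f y.
set n := canc (Y x) (Y y) in h cx1 cx2.
have nE : canc (Y y) (Y z) = n by lia.
have yE : size (Y y) = 2 * n by lia.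
rewrite nE in h cz1 cz2.
set p := take n (Y y); set q := take n (Y z).
have sp : size p = n by rewrite size_takel //; lia.
have sq : size q = n by rewrite size_takel //; lia.
have Yy : Y y = p ++ winv q.
  have := canc_split (Y z) ry; rewrite nE -/q.
  by have -> : size (Y y) - n = n by lia.
have Yx : exists2 u, Y x = u ++ winv p & n <= size u.
  exists (take (size (Y x) - n) (Y x)); first exact: (canc_split (Y y) rx).
  by rewrite size_takel ?leq_subr //; lia.
have Yz : exists2 u, Y z = winv (u ++ winv q) & n <= size u.
  exists (winv (drop n (Y z))); last by rewrite size_winv size_drop; lia.
  by rewrite -winv_cat winvK cat_take_drop.
have pq : p <> q.
  by move=> e; move: ry; rewrite Yy e => /reduced_winv_cat q0; move: yE ny;
  rewrite Yy e q0.
have xy1 : x.1 != y.1.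
  apply/eqP => e; have exy := letter_eq e xy.
  have := canc_self ry; rewrite -size_eq0 -lt0n => /(_ ny).
  by rewrite -{1}exy -/n yE ltnn.
have zy1 : z.1 != y.1.
  apply/eqP => e; have exy := letter_eq (esym e) yz.
  have := canc_self ry; rewrite -size_eq0 -lt0n => /(_ ny).
  by rewrite {2}exy nE yE ltnn.
have [qp|pq'] := ltnP (wval q) (wval p).
  have [t tP] := transvection_exists xy1; have [_ hv] := f_min xy1 tP.
  have [u uE nu] := Yx.
  have w1 : wmul (Y x) (Y y) = u ++ winv q.
    rewrite wmul_canc // -/n uE Yy drop_size_cat // size_cat size_winv sp addnK.
    by rewrite take_size_cat.
  have sl := sum_aut_word_transvection f (@size_winv m) tP.
  have sv := sum_aut_word_transvection f (@wval2_winv m) tP.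
  move: sl sv; rewrite -/(Y x) -/(Y y) w1 uE !size_cat !size_winv sp sq =>
    sl sv.
  have hl : aut_length (f * t)%g = aut_length f by move: sl;
    rewrite /aut_length; lia.
  have := hv hl; have := @wval2_lt m u p q; rewrite sp sq => /(_ erefl nu qp).
  move: sv; rewrite /aut_value; lia.
have qp : wval p < wval q.
  rewrite ltn_neqAle pq' andbT; apply/eqP => e; apply: pq; apply: wval_inj e.
  by rewrite sp sq.
have zy1' : (linv z).1 != (linv y).1 by [].
have [t tP] := transvection_exists zy1'; have [_ hv] := f_min zy1' tP.
have [u uE nu] := Yz.
have YV (s : letter m) : Y (linv s) = winv (Y s) := aut_word_linv f s.
have w1 : wmul (Y (linv z)) (Y (linv y)) = u ++ winv p.
  rewrite wmul_canc ?reduced_aut_word // !YV canc_winv //.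
  rewrite nE uE Yy winvK winv_cat winvK drop_size_cat //.
  by rewrite size_cat size_winv sq addnK take_size_cat.
have sl := sum_aut_word_transvection f (@size_winv m) tP.
have sv := sum_aut_word_transvection f (@wval2_winv m) tP.
move: sl sv; rewrite -/(Y (linv z)) -/(Y (linv y)) w1 YV uE winvK.
rewrite !size_cat !size_winv sp sq => sl sv.
have hl : aut_length (f * t)%g = aut_length f by move: sl; rewrite /aut_length;
  lia.
have := hv hl; have := @wval2_lt m u q p; rewrite sp sq => /(_ erefl nu qp).
move: sv; rewrite /aut_value; lia.
Qed.

(** The reduced word of the preimage is no longer than its image under [f], which is a single
    letter. *)
Lemma minimal_inv_letter i : exists x, (f^-1)%g (fg_gen i) = fg_letter x.
Proof.
case E : ((f^-1)%g (fg_gen i)) => [w rw].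
have fE : f ((f^-1)%g (fg_gen i)) = fg_gen i.
  exact: (congr1 (fun g : aut _ => g (fg_gen i)) (mulgV f)).
have := @size_word_image m Y (@reduced_aut_word f) (@aut_word_nonempty f)
  minimal_canc minimal_canc2 w rw.
rewrite -(aut_wordP f rw) -E fE /=.
case: w rw E {fE} => [|x [|? ?]] rw E // _; last by exists x; rewrite E;
  apply: val_inj.
have := aut_word_nonempty (f^-1)%g (i, false).
by rewrite /aut_word -[fg_letter _]/(fg_gen i) E.
Qed.

End Minimal.
End AutWord.

(** Transvections in [S] lower the length, or the value at equal length, until a local minimum is
    reached; its inverse sends generators to letters. *)
Lemma nielsen m (S : aut (free_group m) -> Prop) :
  (forall f g, S f -> S g -> S (f * g)%g) -> (forall f, S f -> S (f^-1)%g) ->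
  (forall x y, x.1 != y.1 -> exists2 t, S t & transvection t x y) ->
  (forall f : aut (free_group m),
     (forall i, exists x, f (fg_gen i) = fg_letter x) -> S f) ->
  forall f, S f.
Proof.
move=> SM SV ST SL f.
have Tex x y : x.1 != y.1 -> exists t, @transvection m t x y.
  by move=> /ST[t _ ?]; exists t.
have Sdiv g t : S t -> S (g * t)%g -> S g.
  by move=> St Sgt; rewrite -(mulgK t g); apply: SM => //; apply: SV.
have [n] := ubnP (aut_length f); elim: n f => // n IHn f.
rewrite ltnS => fn.
have [v] := ubnP (aut_value f); elim: v f fn => // v IHv f fn.
rewrite ltnS => fv.
have [fmin|] := pselect (nielsen_minimal f).
  rewrite -(invgK f); apply/SV/SL => i; exact: minimal_inv_letter.
move=> /existsNP[t0 /existsNP[x /existsNP[y /not_implyP[xy]]]].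
move=> /not_implyP[tP0 nmin].
(* [S] contains some transvection along [(x, y)], and there is only one. *)
have [t St tP] := ST _ _ xy.
have tt0 : t = t0.
  apply: autP; apply: fg_lift_uniq; [exact: autM | exact: autM |] => i.
  have [->|ix] := eqVneq i x.1; last by rewrite tP.2 // tP0.2.
  case: x xy tP tP0 {nmin} => j [] xy [e1 _] [e2 _] /=;
    last by rewrite -[fg_gen j]/(fg_letter (j, false)) e1 e2.
  have -> : fg_gen j = ((fg_letter (j, true))^-1)%g by apply: val_inj.
  by rewrite !autVg e1 e2.
subst t0; apply: (Sdiv f t St).
move/not_andP: nmin => [/negP|].
  by rewrite -ltnNge => lt; apply: IHn; apply: leq_trans lt fn.
move=> /not_implyP[el /negP]; rewrite -ltnNge => lv.
by apply: IHv; rewrite ?el //; apply: leq_trans lv fv.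
Qed.

(** * A generating set of the automorphism group *)

(** Compares the valuations at sites exchanged by a translation or a reflection of the path. *)
Lemma logn_eq_dvd p e x y : prime p -> ~~ (p ^ e %| x) ->
  (forall d, d <= e -> (p ^ d %| x) = (p ^ d %| y)) -> logn p x = logn p y.
Proof.
move=> pp ex E.
have x0 : 0 < x by case: x ex {E} => //; rewrite dvdn0.
have y0 : 0 < y by move: ex; rewrite (E e) //; case: (y) => //; rewrite dvdn0.
move: ex; rewrite pfactor_dvdn // -ltnNge => ex.
have := E _ (ltnW ex); have := E _ ex.
rewrite !pfactor_dvdn // leqnn ltnn => /esym/negbT;
  rewrite -ltnNge ltnS => h /esym h'.
by apply/eqP; rewrite eqn_leq h' h.
Qed.

(** * Symmetries and connectedness of the labelled path *)

Section PathBlocks.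
Variable k : nat.
Hypothesis k0 : 0 < k.

Lemma exp_block : 2 ^ k = (2 ^ k.-1).*2.
Proof. by case: k k0 => // k' _; rewrite expnS mul2n. Qed.

Lemma v_moves_add v j t : v_moves k v (j + 2 ^ k.-1 * t) = v_moves k v j.
Proof.
rewrite /v_moves dvdn_addl ?dvdn_mulr //; case: (boolP (_ %| j)) => //= dj.
congr (chi v (_ %% 3)); apply/esym/(@logn_eq_dvd _ k.-1) => // d dk.
by rewrite dvdn_addl // dvdn_mulr // dvdn_exp2l.
Qed.

Lemma v_moves_sub v j t : j <= 2 ^ k.-1 * t ->
  v_moves k v (2 ^ k.-1 * t - j) = v_moves k v j.
Proof.
move=> jt; rewrite /v_moves dvdn_subr ?dvdn_mulr //.
case: (boolP (_ %| j)) => //= dj.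
congr (chi v (_ %% 3)); apply/esym/(@logn_eq_dvd _ k.-1) => // d dk.
by rewrite dvdn_subr // dvdn_mulr // dvdn_exp2l.
Qed.

Lemma step_add s t i : step k s (i + 2 ^ k * t) = step k s i + 2 ^ k * t.
Proof.
rewrite exp_block -!muln2; case: s => [v|] /=.
  rewrite /act_v; have -> : uphalf (i + 2 ^ k.-1 * 2 * t) =
    uphalf i + 2 ^ k.-1 * t.
    by rewrite mulnAC; lia.
  rewrite v_moves_add; case: ifP => // mv.
  have i0 : uphalf i != 0 by apply: contraL mv => /eqP ->; rewrite v_moves0.
  have -> : odd (i + 2 ^ k.-1 * 2 * t) =
    odd i by rewrite oddD mulnAC oddM andbF addbF.
  by case: ifP; lia.
rewrite /act_a; case: k k0 => // k' _ /=.
have -> : odd (i + 2 ^ k' * 2 * t) =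
  odd i by rewrite oddD mulnAC oddM andbF addbF.
by case: ifP; lia.
Qed.

Lemma step_lt s t i : i < 2 ^ k * t -> step k s i < 2 ^ k * t.
Proof.
rewrite exp_block -!muln2 mulnAC => it; case: s => [v|] /=.
  rewrite /act_v; case: ifP => // mv; case: ifP => oi; last by lia.
  have : uphalf i != 2 ^ k.-1 * t.
    by apply: contraL mv => /eqP ->; rewrite /v_moves dvdn_mulr.
  lia.
by rewrite /act_a; case: k k0 it => // k' _ /= it; case: ifP; lia.
Qed.

Lemma step_rev s t i : i < 2 ^ k * t ->
  step k s (2 ^ k * t - i.+1) = 2 ^ k * t - (step k s i).+1.
Proof.
rewrite exp_block -!muln2 mulnAC => it; case: s => [v|] /=.
  rewrite /act_v; have -> : uphalf (2 ^ k.-1 * t * 2 - i.+1) =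
    2 ^ k.-1 * t - uphalf i by lia.
  rewrite v_moves_sub; last by lia.
  case: ifP => // mv.
  have i0 : uphalf i != 0 by apply: contraL mv => /eqP ->; rewrite v_moves0.
  have i1 : uphalf i != 2 ^ k.-1 * t.
    by apply: contraL mv => /eqP ->; rewrite /v_moves dvdn_mulr.
  have -> : odd (2 ^ k.-1 * t * 2 - i.+1) = ~~ odd i.+1 (+) true by lia.
  by case: ifP => /=; case: ifP => /=; lia.
rewrite /act_a; case: k k0 it => // k' _ /= it.
have -> : odd (2 ^ k' * t * 2 - i.+1) = ~~ odd i by lia.
by case oi : (odd i) => /=; lia.
Qed.

Lemma step_dist s i : (step k s i <= i.+1) /\ (i <= (step k s i).+1).
Proof.
case: s => [v|] /=; rewrite ?/act_v ?/act_a.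
  by case: ifP => // _; case: ifP; lia.
by case: k k0 => // k' _; case: ifP; lia.
Qed.

Lemma stepK s : involutive (step k s).
Proof. by case: s => [v|] i /=; rewrite ?act_vK ?act_aK. Qed.

(** The edge from an even site is labelled [a]; that from an odd site carries two of [b], [c], [d],
    hence [b] or [c]. *)
Lemma step_adjacent i : ~~ (2 ^ k %| i.+1) -> exists s, step k s i = i.+1.
Proof.
move=> di; have [oi|ei] := boolP (odd i); last first.
  by exists None; rewrite /= /act_a; case: k k0 => // k' _; rewrite (negPf ei).
have mv v : chi v (logn 2 (uphalf i) %% 3) -> step k (Some v) i = i.+1.
  move=> cv; rewrite /= /act_v /v_moves cv oi andbT ifT //.
  apply: contra di => /(dvdn_mul (dvdnn 2)); rewrite -expnS prednK //.
  by have -> : 2 * uphalf i = i.+1 by lia.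
case E : (logn 2 (uphalf i) %% 3) mv => [|[|r]] mv.
- by exists (Some (true, true)); apply: mv.
- by exists (Some (true, true)); apply: mv.
- by exists (Some (true, false)); apply: mv.
Qed.

End PathBlocks.

(** * Permutations, sign changes and transvections of the generators *)

Section BasicAut.
Variable m : nat.
Implicit Types (i j l : 'I_m) (f g : 'I_m -> free_group m).

Lemma fg_lift1 f : fg_lift f 1%g = 1%g.
Proof. by rewrite /fg_lift big_nil. Qed.

Lemma fg_liftV f u : (fg_lift f u^-1 = (fg_lift f u)^-1)%g.
Proof. by apply: (@mulgI _ (fg_lift f u));
  rewrite -fg_liftM !mulgV fg_lift1. Qed.

Lemma fg_lift_cancel f g :
  (forall i, fg_lift f (g i) = fg_gen i) -> cancel (fg_lift g) (fg_lift f).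
Proof.
move=> fg; apply: (@fg_lift_uniq _ _ (fg_lift f \o fg_lift g) id) =>
  // [u v|i] /=.
  by rewrite !fg_liftM.
by rewrite fg_lift_gen fg.
Qed.

Definition lift_aut f g (fg : forall i, fg_lift f (g i) = fg_gen i)
    (gf : forall i, fg_lift g (f i) = fg_gen i) : aut (free_group m) :=
  @Aut _ (fg_lift f) (@fg_liftM m _ f)
    (Bijective (fg_lift_cancel gf) (fg_lift_cancel fg)).

Lemma perm_aut_subproof (s : {perm 'I_m}) i :
  fg_lift (fun i => fg_gen (s i)) (fg_gen ((s^-1)%g i)) = fg_gen i.
Proof. by rewrite fg_lift_gen permKV. Qed.

Lemma perm_aut_subproof2 (s : {perm 'I_m}) i :
  fg_lift (fun i => fg_gen ((s^-1)%g i)) (fg_gen (s i)) = fg_gen i.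
Proof. by rewrite fg_lift_gen permK. Qed.

Definition perm_aut s := lift_aut (perm_aut_subproof s) (perm_aut_subproof2 s).

Lemma perm_autE s i : perm_aut s (fg_gen i) = fg_gen (s i).
Proof. exact: fg_lift_gen. Qed.

Definition flip_image i l : free_group m :=
  if l == i then ((fg_gen i)^-1)%g else fg_gen l.

Lemma flip_aut_subproof i l :
  fg_lift (flip_image i) (flip_image i l) = fg_gen l.
Proof.
rewrite {2}/flip_image; case: eqP => [->|/eqP li].
  by rewrite fg_liftV fg_lift_gen /flip_image eqxx invgK.
by rewrite fg_lift_gen /flip_image (negPf li).
Qed.

Definition flip_aut i := lift_aut (flip_aut_subproof i) (flip_aut_subproof i).

Lemma flip_autE i l : flip_aut i (fg_gen l) = flip_image i l.
Proof. exact: fg_lift_gen. Qed.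

Definition trans_image i (u : free_group m) l : free_group m :=
  if l == i then (fg_gen i * u)%g else fg_gen l.

Lemma trans_aut_subproof i j (ij : i != j) l :
  fg_lift (trans_image i (fg_gen j)) (trans_image i (fg_gen j)^-1%g l) =
    fg_gen l.
Proof.
rewrite {2}/trans_image; case: eqP => [->|/eqP li].
  rewrite fg_liftM fg_liftV !fg_lift_gen /trans_image eqxx eq_sym (negPf ij).
  by rewrite mulgK.
by rewrite fg_lift_gen /trans_image (negPf li).
Qed.

Lemma trans_aut_subproof2 i j (ij : i != j) l :
  fg_lift (trans_image i (fg_gen j)^-1%g) (trans_image i (fg_gen j) l) =
    fg_gen l.
Proof.
rewrite {2}/trans_image; case: eqP => [->|/eqP li].
  rewrite fg_liftM !fg_lift_gen /trans_image eqxx eq_sym (negPf ij).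
  by rewrite mulgKV.
by rewrite fg_lift_gen /trans_image (negPf li).
Qed.

Definition trans_aut i j (ij : i != j) :=
  lift_aut (trans_aut_subproof ij) (trans_aut_subproof2 ij).

Lemma trans_autE i j (ij : i != j) l :
  trans_aut ij (fg_gen l) = trans_image i (fg_gen j) l.
Proof. exact: fg_lift_gen. Qed.

Lemma autE_gen (f g : aut (free_group m)) :
  (forall i, f (fg_gen i) = g (fg_gen i)) -> f = g.
Proof. by move=> fg; apply/autP/fg_lift_uniq => //; apply: autM. Qed.

Lemma autK_mulV (f : aut (free_group m)) u : f (f^-1%g u) = u.
Proof. exact: (congr1 (fun g : aut _ => g u) (mulgV f)). Qed.

Lemma autVK_mul (f : aut (free_group m)) u : f^-1%g (f u) = u.
Proof. exact: (congr1 (fun g : aut _ => g u) (mulVg f)). Qed.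

Lemma trans_autVE i j (ij : i != j) l :
  (trans_aut ij)^-1%g (fg_gen l) = trans_image i (fg_gen j)^-1%g l.
Proof.
apply: (bij_inj (aut_bij (trans_aut ij))); rewrite autK_mulV.
by rewrite /= trans_aut_subproof.
Qed.

(** Permutations compose from left to right, automorphisms from right to left. *)
Lemma perm_autM (s t : {perm 'I_m}) :
  perm_aut (s * t)%g = (perm_aut t * perm_aut s)%g.
Proof. by apply: autE_gen => i;
  rewrite perm_autE /= -!/(perm_aut _ _) !fg_lift_gen permM. Qed.

Lemma perm_aut1 : perm_aut 1%g = 1%g.
Proof. by apply: autE_gen => i; rewrite perm_autE perm1. Qed.

Lemma perm_autV s : perm_aut (s^-1)%g = ((perm_aut s)^-1)%g.
Proof. by apply: (@mulgI _ (perm_aut s));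
  rewrite -perm_autM mulVg mulgV perm_aut1. Qed.

Lemma flip_autV i : ((flip_aut i)^-1)%g = flip_aut i.
Proof.
apply: (@mulgI _ (flip_aut i)); rewrite mulgV; apply: autE_gen => l.
by rewrite /= fg_lift_gen flip_aut_subproof.
Qed.

End BasicAut.

(** * From transpositions, one sign change and one transvection to the whole group *)

Section SubgroupOfAut.
Variables (m : nat) (S : aut (free_group m) -> Prop).
Hypotheses (SM : forall f g, S f -> S g -> S (f * g)%g)
           (SV : forall f, S f -> S (f^-1)%g) (S1 : S 1%g).
Implicit Types (i j l : 'I_m).

Definition linked i j := S (perm_aut (tperm i j)).

Lemma linked_refl i : linked i i.
Proof. by rewrite /linked tperm1 perm_aut1. Qed.

Lemma linked_sym i j : linked i j -> linked j i.
Proof. by rewrite /linked tpermC. Qed.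

Lemma S_conj (s t : {perm 'I_m}) :
  S (perm_aut s) -> S (perm_aut t) -> S (perm_aut (s ^ t)%g).
Proof.
by move=> Ss St; rewrite conjgE !perm_autM perm_autV; do !apply: SM;
  rewrite //; apply: SV.
Qed.

Lemma linked_image (t : {perm 'I_m}) i j :
  S (perm_aut t) -> linked i j -> linked (t i) (t j).
Proof. by move=> St ij; rewrite /linked -tpermJ; apply: S_conj. Qed.

Lemma linked_trans i j l : linked i j -> linked j l -> linked i l.
Proof.
move=> ij jl; have [-> //|ji] := eqVneq i j.
have [->|li] := eqVneq i l; first exact: linked_refl.
by have := linked_image jl ij; rewrite tpermL tpermD // eq_sym.
Qed.

Hypothesis all_linked : forall i j, linked i j.

Lemma S_perm s : S (perm_aut s).
Proof.
have [ts -> _] := prod_tpermP s; elim: ts => [|t ts IH].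
  by rewrite big_nil perm_aut1.
by rewrite big_cons perm_autM; apply: SM => //; apply: all_linked.
Qed.

Variables (i0 j0 : 'I_m) (ij0 : i0 != j0) (l0 : 'I_m).
Hypotheses (S_flip0 : S (flip_aut l0)) (S_trans0 : S (trans_aut ij0)).

Lemma S_flip l : S (flip_aut l).
Proof.
have -> : flip_aut l = (perm_aut (tperm l0 l) * flip_aut l0 * perm_aut (tperm
  l0 l))%g.
  apply: autE_gen => j; rewrite /= !fg_lift_gen /flip_image.
  have -> : (tperm l0 l j == l0) = (j == l).
    by rewrite -(inj_eq (@perm_inj _ (tperm l0 l))) tpermK tpermL.
  case: eqP => [_|_]; last by rewrite fg_lift_gen tpermK.
  by rewrite fg_liftV fg_lift_gen tpermL.
by apply: SM; [apply: SM => //; apply: S_perm | apply: S_perm].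
Qed.

Definition flip_all (P : pred 'I_m) :=
  (\prod_(i <- enum 'I_m | P i) flip_aut i)%g.

Lemma flip_allE P j :
  flip_all P (fg_gen j) = if P j then ((fg_gen j)^-1)%g else fg_gen j.
Proof.
rewrite /flip_all; have : uniq (enum 'I_m) by apply: enum_uniq.
have -> : P j = (j \in enum 'I_m) && P j by rewrite mem_enum.
elim: (enum 'I_m) => [|i s IH] /=; first by rewrite big_nil.
case/andP=> is_ us; rewrite big_cons inE; case Pi : (P i); last first.
  by rewrite IH //; case: eqVneq => [->|]; rewrite // Pi !andbF.
rewrite [LHS]/= IH //; have [->|ji] := eqVneq j i.
  by rewrite (negPf is_) Pi fg_lift_gen /flip_image eqxx.
by rewrite orFb; case: ifP => _;
  rewrite ?fg_liftV fg_lift_gen /flip_image (negPf ji).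
Qed.

Lemma S_flip_all P : S (flip_all P).
Proof.
rewrite /flip_all; elim: (enum 'I_m) => [|i s IH]; first by rewrite big_nil.
by rewrite big_cons; case: (P i) => //; apply: SM => //; apply: S_flip.
Qed.

Lemma letterE (x : letter m) :
  fg_letter x = if x.2 then ((fg_gen x.1)^-1)%g else fg_gen x.1.
Proof. by case: x => i []; apply: val_inj. Qed.

(** Such an [f] is a sign change followed by a permutation: the indices of the letters are distinct
    because [f] is injective on generators and their inverses. *)
Lemma S_letter_aut (f : aut (free_group m)) :
  (forall i, exists x, f (fg_gen i) = fg_letter x) -> S f.
Proof.
move=> fx; pose x i := sval (cid (fx i)).
have xP i : f (fg_gen i) = fg_letter (x i) by exact: svalP (cid (fx i)).
have sI : injective (fun i => (x i).1).
  move=> i j /= e.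
  have : fg_gen j = fg_gen i \/ fg_gen j = ((fg_gen i)^-1)%g.
    have [b|b] := eqVneq (x i).2 (x j).2; [left|right];
      apply: (bij_inj (aut_bij f)); rewrite ?autVg !xP !letterE e.
      by rewrite b.
    by case: (x i).2 (x j).2 b => [] [] //; rewrite ?invgK.
  by case=> /(congr1 (@fg_word m)) [].
have -> : f = (perm_aut (perm sI) * flip_all (fun i => (x i).2))%g.
  apply: autE_gen => i; rewrite xP letterE [RHS]/= flip_allE.
  by case: ifP => _; rewrite ?fg_liftV fg_lift_gen permE.
by apply: SM; [apply: S_perm | apply: S_flip_all].
Qed.

(** Conjugate [trans_aut ij0] by a signed permutation carrying the generators [i0] and [j0] to [x]
    and [y]. *)
Lemma S_transvection (x y : letter m) : x.1 != y.1 ->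
  exists2 t, S t & transvection t x y.
Proof.
move=> xy; have [s [si sj]] : exists s : {perm 'I_m}, s i0 = x.1 /\ s j0 = y.1.
  exists (tperm i0 x.1 * tperm (tperm i0 x.1 j0) y.1)%g.
  have c : tperm i0 x.1 j0 != x.1.
    by rewrite -[eqbRHS](tpermL i0 x.1) (inj_eq perm_inj) eq_sym.
  by split; rewrite permM tpermL //; apply: tpermD; rewrite // eq_sym.
pose P l := (l == i0) && x.2 || (l == j0) && y.2.
pose f := (perm_aut s * flip_all P)%g.
have Sf : S f by apply: SM; [apply: S_perm | apply: S_flip_all].
have fE l : f (fg_gen l) = if P l then ((fg_gen (s l))^-1)%g else fg_gen (s l).
  rewrite /f [LHS]/= flip_allE.
  by case: ifP => _; rewrite ?fg_liftV fg_lift_gen.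
have fx : fg_letter x = f (fg_gen i0).
  by rewrite fE letterE si /P eqxx (negPf ij0) orbF.
have fy : fg_letter y = f (fg_gen j0).
  by rewrite fE letterE sj /P eqxx eq_sym (negPf ij0).
exists (f * trans_aut ij0 * f^-1)%g; first by do !apply: SM => //; apply: SV.
split=> [|l lx]; rewrite -[LHS]/(f (trans_aut ij0 (f^-1%g _))).
  by rewrite fx autVK_mul trans_autE /trans_image eqxx autM -fx -fy.
pose l' := (s^-1)%g l; have sl : s l' = l by rewrite permKV.
have l'i : l' != i0 by apply: contraNneq lx => e; rewrite -sl e si.
have tl : trans_aut ij0 (fg_gen l') = fg_gen l'.
  by rewrite trans_autE /trans_image (negPf l'i).
have : f (trans_aut ij0 (f^-1%g (f (fg_gen l')))) = f (fg_gen l').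
  by rewrite autVK_mul tl.
by rewrite fE sl; case: (P l') => //; rewrite !autVg => /invg_inj.
Qed.

Lemma S_all f : S f.
Proof.
apply: nielsen f => //; [exact: S_transvection | exact: S_letter_aut].
Qed.

End SubgroupOfAut.

(** * The generating sets *)

Section Generators.
Variable n : nat.
Notation N := (2 ^ (n + 2)).
Notation M := (2 ^ n.+1).
Notation k := n.+1.

Lemma expn_add2 : N = M * 2.
Proof. by rewrite addn2 expnS mulnC. Qed.

Lemma two_le_block : 1 < M.
Proof. by rewrite expnS; have := expn_gt0 2 n; lia. Qed.

Definition site (a : nat) : 'I_N :=
  insubd (Ordinal (expn_gt0 2 (n + 2) : 0 < N)) a.

Lemma siteE a : a < N -> site a = a :> nat.
Proof. by move=> aN; rewrite val_insubd aN. Qed.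

Lemma site_val (i : 'I_N) : site i = i.
Proof. by apply: val_inj; rewrite /= siteE. Qed.

Lemma step_ltN s i : i < N -> step k s i < N.
Proof. by rewrite expn_add2; apply: step_lt. Qed.

Definition step_site s (i : 'I_N) : 'I_N := site (step k s i).

Lemma step_siteE s i : step_site s i = step k s i :> nat.
Proof. by rewrite /step_site siteE // step_ltN. Qed.

Lemma step_siteK s : involutive (step_site s).
Proof. by move=> i; apply: val_inj; rewrite /= !step_siteE stepK. Qed.

Definition step_perm s : {perm 'I_N} := perm (can_inj (step_siteK s)).

Lemma step_permE s i : step_perm s i = step k s i :> nat.
Proof. by rewrite permE step_siteE. Qed.

Lemma sites_neq : site 0 != site N.-1.
Proof.
rewrite -val_eqE /= !siteE //; have := two_le_block; rewrite expn_add2; lia.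
Qed.

(* Sites [0] and [N - 1] are fixed ends of the two blocks of length [M], and
   so are [M - 1] and [M]; [M - 2] is the neighbour of [M - 1]. *)
Definition gen_aut : seq (aut (free_group N)) :=
  [seq perm_aut (step_perm s) | s <- enum {: option klein}] ++
  [:: perm_aut (tperm (site M.-2) (site M.-1));
      perm_aut (tperm (site M.-1) (site M));
      flip_aut (site M.-1); trans_aut sites_neq].

Definition gen_set : {fset aut (free_group N)} :=
  [fset g in gen_aut]%fset.

Lemma mem_gen_set g : (g \in gen_set) = (g \in gen_aut).
Proof. by rewrite in_fset. Qed.

Definition spanned (g : aut (free_group N)) : Prop :=
  exists2 w, is_word gen_set w & g = (\prod_(s <- w) s)%g.

Lemma spannedM f g : spanned f -> spanned g -> spanned (f * g)%g.
Proof.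
move=> [u Su ->] [v Sv ->]; exists (u ++ v); last by rewrite big_cat.
by rewrite /is_word all_cat; apply/andP.
Qed.

Lemma spanned1 : spanned 1%g.
Proof. by exists [::]; rewrite // big_nil. Qed.

Lemma spannedV f : spanned f -> spanned (f^-1)%g.
Proof.
case=> w Sw ->; elim: w Sw => [|s w IH] /=.
  by rewrite big_nil invg1 => _; apply: spanned1.
case/andP=> Ss /IH Sw; rewrite big_cons invgM; apply: spannedM => //.
by exists [:: (s^-1)%g]; rewrite ?big_seq1 //= invgK orbC Ss.
Qed.

Lemma spanned_gen g : g \in gen_aut -> spanned g.
Proof.
by move=> gA; exists [:: g]; rewrite ?big_seq1 //= mem_gen_set gA.
Qed.

Lemma spanned_step s : spanned (perm_aut (step_perm s)).
Proof.
apply: spanned_gen; rewrite /gen_aut mem_cat; apply/orP; left; apply/mapP.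
by exists s; rewrite ?mem_enum.
Qed.

Lemma linked_gen i j :
  perm_aut (tperm i j) \in gen_aut -> linked spanned i j.
Proof. exact: spanned_gen. Qed.

Lemma step_last s : step k s M.-1 = M.-1 \/ step k s M.-1 = M.-2.
Proof.
have oM : odd M.-1 = true by rewrite expnS; have := expn_gt0 2 n; lia.
case: s => [v|] /=; [left|right].
  rewrite /act_v /v_moves; have -> : uphalf M.-1 = 2 ^ n by rewrite expnS;
    have := expn_gt0 2 n; lia.
  by rewrite dvdnn.
by rewrite /act_a oM; have := two_le_block; case: (M).
Qed.

(** Conjugation by a step moves the pair; if [M.-1] goes to [M.-2], the transposition of these two
    sites brings it back. *)
Lemma step_linked s i : linked spanned (site M.-1) (site i) -> i < N ->
  linked spanned (site M.-1) (site (step k s i)).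
Proof.
move=> li iN; have := two_le_block => M2.
have := linked_image spannedM spannedV (spanned_step s) li.
have -> : step_perm s (site i) = site (step k s i).
  by apply: val_inj; rewrite /= step_permE !siteE // step_ltN.
have -> : step_perm s (site M.-1) = site (step k s M.-1).
  by apply: val_inj; rewrite /= step_permE !siteE // ?step_ltN // expn_add2;
    lia.
case: (step_last s) => -> //.
move=> h; apply: (linked_trans spannedM spannedV spanned1 _ h).
apply: linked_sym; apply: linked_gen;
  rewrite /gen_aut mem_cat !inE eqxx ?orbT //.
Qed.

Lemma all_linked i j : linked spanned i j.
Proof.
have M2 := two_le_block.
suff H i' : i' < N -> linked spanned (site M.-1) (site i').
  rewrite -(site_val i) -(site_val j).
  apply: (linked_trans spannedM spannedV spanned1 _ (H _ (ltn_ord j))).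
  by apply: linked_sym; apply: H.
have lM1 : linked spanned (site M.-1) (site M.-1) := linked_refl spanned1 _.
have lM : linked spanned (site M.-1) (site M).
  by apply: linked_gen; rewrite /gen_aut mem_cat !inE eqxx ?orbT.
(* Neighbours in the block [t] are exchanged by a step; [lM] bridges the two blocks. *)
have adj t i1 : M * t <= i1 -> i1.+1 < M * t.+1 -> i1.+1 < N ->
    linked spanned (site M.-1) (site i1) <->
      linked spanned (site M.-1) (site i1.+1).
  move=> ti it iN; have [|s si] := @step_adjacent k isT i1.
    apply/negP => /dvdnP[q E]; move: ti it;
      rewrite -ltnS E mulnC !ltn_pmul2r ?expn_gt0 //.
    by rewrite [M * _]mulnC ltn_pmul2r ?expn_gt0 //; lia.
  split=> l; last by have := step_linked s l iN; rewrite -si stepK.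
  by have := step_linked s l (ltnW iN); rewrite si.
have left i1 : i1 < M -> linked spanned (site M.-1) (site i1).
  move=> iM; have : M.-1 - (M.-1 - i1) = i1 by lia.
  move: (M.-1 - i1) => d <-; elim: d {i1 iM} => [|d IH]; first by rewrite subn0.
  (* From [d = M.-1] on the truncated subtraction stays at [0]. *)
  have [dM|dM] := ltnP d M.-1; last by have -> : M.-1 - d.+1 = M.-1 - d by lia.
  apply/(adj 0); rewrite ?muln0 ?muln1 // ?expn_add2; try lia.
  by have -> : (M.-1 - d.+1).+1 = M.-1 - d by lia.
move=> iN; have [/left//|Mi] := ltnP i' M.
have {Mi} := subnKC Mi; move: (i' - M) => d E; move: iN; rewrite -{}E.
elim: d => [|d IH]; first by rewrite addn0.
rewrite addnS => dN; have h1 : M * 1 <= M + d by rewrite muln1 leq_addr.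
have h2 : (M + d).+1 < M * 2 by rewrite -expn_add2.
exact: (proj1 (adj 1 _ h1 h2 dN) (IH (ltnW dN))).
Qed.

Lemma gen_set_generates : generates gen_set.
Proof.
apply: (S_all spannedM spannedV spanned1 all_linked (ij0 := sites_neq) (l0 :=
  site M.-1)).
- by apply: spanned_gen; rewrite /gen_aut mem_cat !inE eqxx ?orbT.
- by apply: spanned_gen; rewrite /gen_aut mem_cat !inE eqxx ?orbT.
Qed.

End Generators.

(** * Short words in the generators *)

Lemma autXg (G : groupType) (f : aut G) x i : (f (x ^+ i) = f x ^+ i)%g.
Proof. by elim: i => [|i IH]; rewrite ?expg0 ?aut1g // !expgS autM IH. Qed.

Lemma aut_letter m (f : aut (free_group m)) (x y : letter m) :
  f (fg_gen x.1) = fg_letter y ->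
  f (fg_letter x) = fg_letter (if x.2 then linv y else y).
Proof.
move=> fxy; rewrite [in LHS]letterE; case: x.2; last exact: fxy.
by rewrite autVg fxy fg_letter_linv.
Qed.

Lemma prefix_points_le k p w x :
  x \in prefix_points k.+1 p w -> x <= p + size w.
Proof.
elim: w x => [|s w IH] x /=; first by rewrite inE addn0 => /eqP ->.
rewrite inE => /predU1P[->|]; first exact: leq_addr.
case/mapP=> y /IH yp ->; have [+ _] := @step_dist k.+1 isT s y; lia.
Qed.

Lemma mem_prefix_points k p w : p \in prefix_points k p w.
Proof. by case: w => [|? ?]; rewrite inE eqxx. Qed.

Lemma mem_prefix_points_cons k p s w x :
  x \in prefix_points k p w -> step k s x \in prefix_points k p (s :: w).
Proof. by move=> xw; rewrite /= inE map_f ?orbT. Qed.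

Lemma act_a0 k : act_a k.+1 0 = 1.
Proof. by []. Qed.

Section Description.
Variables (n B : nat).
Notation N := (2 ^ (n + 2)).
Notation M := (2 ^ n.+1).
Notation k := n.+1.
Hypothesis BM : B + 3 < M.
Implicit Types (w : seq (option klein)) (i : 'I_N).

Let pts0 w := prefix_points k 0 w.
Let pts1 w := prefix_points k (act_a k 0) w.

(** The inverted orbits of [M.-1], [M.-2] and [M], obtained from those of [0] and [1] by reflecting
    the left block and translating to the right one. *)
Definition central_points w : seq nat :=
  [seq M.-1 - x | x <- pts0 w ++ pts1 w] ++ [seq M + x | x <- pts0 w].

Definition core : seq nat := [:: M.-2; M.-1; M].

Lemma core_central w : {subset core <= central_points w}.
Proof.
have p0 : 0 \in pts0 w by apply: mem_prefix_points.
have p1 : 1 \in pts1 w by apply: mem_prefix_points.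
move=> x; rewrite !inE mem_cat => /or3P[] /eqP ->; apply/orP.
- left; apply/mapP; exists 1; first by rewrite mem_cat p1 orbT.
  by lia.
- by left; apply/mapP; exists 0; rewrite ?subn0 // mem_cat p0.
- by right; apply/mapP; exists 0; rewrite ?addn0.
Qed.

Lemma central_points_bound w x : size w <= B -> x \in central_points w ->
  M - (B + 2) <= x <= M + B.
Proof.
move=> wB; rewrite mem_cat => /orP[] /mapP[y]; rewrite ?mem_cat.
  move=> yw ->; have : y <= B.+1; last lia.
  case/orP: yw => /prefix_points_le; rewrite ?act_a0; lia.
by move=> /prefix_points_le yw ->; lia.
Qed.

Lemma central_points_cons s w x : size w <= B -> x \in central_points w ->
  step k s x \in central_points (s :: w).
Proof.
move=> wB; rewrite !mem_cat => /orP[] /mapP[y]; rewrite ?mem_cat => yw ->.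
  have yM : y < M * 1.
    by rewrite muln1; case/orP: yw => /prefix_points_le; rewrite ?act_a0; lia.
  apply/orP; left; apply/mapP; exists (step k s y).
    by rewrite mem_cat; case/orP: yw => yw; apply/orP; [left|right];
      apply: mem_prefix_points_cons.
  have := @step_rev k isT s 1 y yM; rewrite muln1.
  have -> : M - y.+1 = M.-1 - y by lia.
  by move=> ->; lia.
apply/orP; right; apply/mapP; exists (step k s y).
  exact: mem_prefix_points_cons.
by have := @step_add k isT s 1 y; rewrite muln1 addnC => ->; rewrite addnC.
Qed.

(* The exponent of the last generator is [e - B]. *)
Definition end_value i (e : nat) : free_group N :=
  (fg_gen i * (fg_gen (rev_ord i) ^- B * fg_gen (rev_ord i) ^+ e))%g.

(** The effect at one site of a product of conjugates: nothing, a power of the opposite generator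
    near site [0], or a signed permutation near the centre. A word of length [lw] changes the
    exponent by at most [lw]. *)
Inductive local_value (lw : nat) w i (u : free_group N) : Prop :=
| LocalId of u = fg_gen i
| LocalEnd e of (i : nat) \in pts0 w & e <= B + lw & B <= e + lw &
  u = end_value i e
| LocalCentral (x : letter N) of (i : nat) \in central_points w &
    (x.1 : nat) \in central_points w & u = fg_letter x.

Definition described lw w (L : 'I_N -> free_group N) (f : aut (free_group N)) :=
  [/\ size w <= lw,
      forall i, f (fg_gen i) = L (site n (path_act k w i)) &
      forall i, local_value lw w i (L i)].

Lemma path_act_lt w (i : 'I_N) : path_act k w i < N.
Proof. by elim: w => //= s w IH; apply: step_ltN. Qed.

(** The two ends move in parallel, so conjugates of the transvection keep the shape of
    [end_value]. *)
Lemma step_rev_ord s i : step_perm n s (rev_ord i) = rev_ord (step_perm n s i).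
Proof.
apply: val_inj; rewrite /= !step_permE /=.
by have := @step_rev k isT s 2 i; rewrite -expn_add2; apply.
Qed.

(** The values [L] are conjugated by the step, an involution, which moves their support along the
    inverted orbits of the longer word. *)
Lemma described_step lw s w L f : lw < B -> described lw w L f ->
  described lw.+1 (s :: w) (fun i =>
    perm_aut (step_perm n s) (L (step_perm n s i)))
    (perm_aut (step_perm n s) * f)%g.
Proof.
move=> lB [wl fL Lv]; set sg := perm_aut _.
have sgK i : step_perm n s (step_perm n s i) = i.
  by rewrite !permE step_siteK.
have sgE i : sg (fg_gen i) = fg_gen (step_perm n s i) by rewrite perm_autE.
split=> // i; first rewrite -[LHS]/(sg (f _)) fL.
  congr (sg (L _)); rewrite -[LHS]sgK; congr (step_perm n s _).
  apply: ord_inj; rewrite step_permE siteE ?path_act_lt // siteE //.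
  exact: (path_act_lt (s :: w)).
set j := step_perm n s i; have ij : i = step_perm n s j by rewrite /j sgK.
have ijv : (i : nat) = step k s j by rewrite {1}ij step_permE.
case: (Lv j) => [->|e jw e1 e2 ->|x jw xw ->].
- by apply: LocalId; rewrite sgE -ij.
- apply: (@LocalEnd _ _ _ _ e); [|lia|lia|].
    by rewrite ijv mem_prefix_points_cons.
  rewrite /end_value !autM autVg !autXg !sgE -ij.
  by rewrite step_rev_ord -ij.
- apply: (@LocalCentral _ _ _ _ (step_perm n s x.1, x.2)).
  + by rewrite ijv central_points_cons //; lia.
  + by rewrite /= step_permE central_points_cons //; lia.
  have h : sg (fg_gen x.1) =
    fg_letter (step_perm n s x.1, false) by rewrite sgE.
  by rewrite (aut_letter h); case: x.2.
Qed.

Definition core_aut (s : aut (free_group N)) : Prop :=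
  (forall i, (i : nat) \notin core -> s (fg_gen i) = fg_gen i) /\
  (forall i, (i : nat) \in core ->
     exists2 x : letter N, (x.1 : nat) \in core & s (fg_gen i) = fg_letter x).

Lemma pts0_not_core w i : size w <= B -> (i : nat) \in pts0 w ->
  (i : nat) \notin core /\ (rev_ord i : nat) \notin core /\
    rev_ord i != site n 0.
Proof.
move=> wB /prefix_points_le iw; rewrite !inE -val_eqE /= siteE ?expn_gt0 //.
by have := expn_add2 n; lia.
Qed.

(** The core is disjoint from both ends and contained in all sets of central points, so only values
    at central sites change. *)
Lemma described_core lw s w L f : lw < B -> core_aut s -> described lw w L f ->
  described lw.+1 w (fun i => s (L i)) (s * f)%g.
Proof.
move=> lB [s1 s2] [wl fL Lv]; split=> [|i|i]; first by lia.
  by rewrite -fL.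
case: (Lv i) => [->|e iw e1 e2 ->|x iw xw ->].
- have [ic|ic] := boolP ((i : nat) \in core); last by apply: LocalId;
  rewrite s1.
  have [x xc ->] := s2 _ ic.
  by apply: (@LocalCentral _ _ _ _ x) => //; apply: core_central.
- have [|ic [rc _]] := @pts0_not_core w i _ iw; first by lia.
  apply: (@LocalEnd _ _ _ _ e) => //; [lia|lia|].
  by rewrite /end_value !autM autVg !autXg !s1.
have [xc|xc] := boolP ((x.1 : nat) \in core); last first.
  have h : s (fg_gen x.1) = fg_letter (x.1, false) by rewrite s1.
  apply: (@LocalCentral _ _ _ _ x) => //.
  by rewrite (aut_letter h); case: (x) => j [].
have [y yc h] := s2 _ xc.
apply: (@LocalCentral _ _ _ _ (if x.2 then linv y else y)) => //.
  by case: x.2; apply: core_central.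
by rewrite (aut_letter h).
Qed.

(** Only the exponent at site [0] changes: the other end values and the central letters do not
    involve that generator. The boolean [b] selects the inverse. *)
Lemma described_trans lw (b : bool) (s : aut (free_group N)) w L f : lw < B ->
  (forall i, s (fg_gen i) = trans_image (site n 0)
     (if b then (fg_gen (site n N.-1))^-1%g else fg_gen (site n N.-1)) i) ->
  described lw w L f -> described lw.+1 w (fun i => s (L i)) (s * f)%g.
Proof.
move=> lB sE [wl fL Lv]; split=> [|i|i]; first by lia.
  by rewrite -fL.
have s1 j : j != site n 0 -> s (fg_gen j) = fg_gen j.
  by move=> j0; rewrite sE /trans_image (negPf j0).
have rev0 : rev_ord (site n 0) = site n N.-1.
  by apply: val_inj; rewrite /= !siteE ?expn_gt0 // ?subn1 // prednK ?expn_gt0.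
have s0 e : 0 < e ->
    s (end_value (site n 0) e) =
      end_value (site n 0) (if b then e.-1 else e.+1).
  move=> e0; rewrite /end_value rev0 !autM autVg !autXg sE.
  rewrite s1; last by rewrite eq_sym sites_neq.
  rewrite /trans_image eqxx -!mulgA; congr (_ * _)%g.
  set u := fg_gen _; have uB : commute u (u ^- B)%g.
    exact/commuteV/commuteX.
  case: b {sE} => /=; rewrite !mulgA; last by rewrite uB -!mulgA -expgS.
  have -> : (u^-1 * u ^- B = u ^- B * u^-1)%g.
    by apply/commute_sym; apply: commuteV; apply: commute_sym.
  by rewrite -!mulgA -{1}(prednK e0) expgS mulKg.
have end_ok e : e <= B + lw -> B <= e + lw ->
    let e' := if b then e.-1 else e.+1 in e' <= B + lw.+1 /\ B <= e' + lw.+1.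
  by case: b {sE s0} => /=; lia.
(* As [lw < B], the predecessor of [e] is never truncated. *)
have e0 e : B <= e + lw -> 0 < e by lia.
case: (Lv i) => [->|e iw e1 e2 ->|x iw xw ->].
- have [->|i0] := eqVneq i (site n 0); last by apply: LocalId; rewrite s1.
  (* A generator not yet changed is the end value with [e = B], that is, exponent zero. *)
  have [e1 e2] := end_ok B (leq_addr _ _) (leq_addr _ _).
  apply: (@LocalEnd _ _ _ _ (if b then B.-1 else B.+1)) => //.
    by rewrite siteE ?expn_gt0 // mem_prefix_points.
  rewrite -s0 ?(e0 B) ?leq_addr //; congr (s _).
  by rewrite /end_value mulVg mulg1.
- have [|_ [_ r0]] := @pts0_not_core w i _ iw; first by lia.
  have [i0|i0] := eqVneq i (site n 0).
    have [e3 e4] := end_ok e e1 e2.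
    apply: (@LocalEnd _ _ _ _ (if b then e.-1 else e.+1)) => //.
    by rewrite i0 s0 // e0.
  apply: (@LocalEnd _ _ _ _ e) => //; [lia|lia|].
  by rewrite /end_value !autM autVg !autXg !s1.
apply: (@LocalCentral _ _ _ _ x) => //.
have h : s (fg_gen x.1) = fg_letter (x.1, false).
  rewrite s1 //; rewrite -val_eqE /= siteE ?expn_gt0 //.
  have wB : size w <= B by lia.
  by have := central_points_bound wB xw; lia.
by rewrite (aut_letter h); case: (x) => j [].
Qed.

End Description.

Lemma growth_le_card (G : groupType) (S : {fset G}) l (C : finType)
    (P : G -> C -> Prop) :
  (forall g, word_ball S l g -> exists c, P g c) ->
  (forall g h c, P g c -> P h c -> g = h) -> growth S l <= #|C|.
Proof.
move=> ex inj; rewrite /growth cardfE.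
have ballP (x : fset_set (word_ball S l)) : word_ball S l (val x).
  by have := valP x; rewrite in_fset_set ?inE //; apply: finite_word_ball.
have [c cP] := choice (fun x => ex _ (ballP x)).
apply: (leq_card c) => x y e; apply: val_inj; apply: inj (cP x) _.
by rewrite e.
Qed.

(** * Coding and counting short words *)

Section Counting.
Variables (n B : nat).
Notation N := (2 ^ (n + 2)).
Notation M := (2 ^ n.+1).
Notation k := n.+1.
Hypothesis BM : B + 3 < M.
Implicit Types (w : seq (option klein)) (i : 'I_N).

Lemma described1 : described B 0 [::] (@fg_gen N) 1%g.
Proof.
split=> // i; last exact: LocalId.
by congr fg_gen; apply: val_inj; rewrite /= siteE.
Qed.

Lemma core_lt x : x \in core n -> x < N.
Proof.
have := two_le_block n; have := expn_add2 n.
by rewrite !inE => ? ? /or3P[] /eqP ->; lia.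
Qed.

Lemma core_tperm x y : x \in core n -> y \in core n ->
  core_aut (perm_aut (tperm (site n x) (site n y))).
Proof.
move=> xc yc; split=> i ic; rewrite perm_autE.
  rewrite tpermD // -val_eqE /= siteE ?core_lt //.
    by apply: contraNneq ic => <-.
  by apply: contraNneq ic => <-.
exists (tperm (site n x) (site n y) i, false) => //=.
by case: tpermP => // _; rewrite siteE ?core_lt.
Qed.

Lemma core_flip x : x \in core n -> core_aut (flip_aut (site n x)).
Proof.
move=> xc; split=> i ic; rewrite flip_autE /flip_image.
  by case: eqP => // e; rewrite e siteE ?core_lt // xc in ic.
case: eqP => [_|_]; last by exists (i, false).
exists (site n x, true); first by rewrite siteE ?core_lt.
by apply: val_inj.
Qed.

Lemma step_permV s : ((step_perm n s)^-1)%g = step_perm n s.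
Proof.
have e : (step_perm n s * step_perm n s = 1)%g.
  by apply/perm.permP => i; rewrite permM perm1 !permE step_siteK.
by apply: (mulgI (step_perm n s)); rewrite mulgV e.
Qed.

(** All generators but the transvection are involutions, so only for the latter does the inverse
    need another description. *)
Lemma described_cons lw s w L f : lw < B ->
  (s \in gen_set n) || ((s^-1)%g \in gen_set n) -> described B lw w L f ->
  exists w' L', described B lw.+1 w' L' (s * f)%g.
Proof.
move=> lB sS fD.
have step_case p : s = perm_aut (step_perm n p) ->
    exists w' L', described B lw.+1 w' L' (s * f)%g.
  by move=> ->; eexists; eexists; apply: (described_step BM p lB fD).
have core_case : core_aut s -> exists w' L', described B lw.+1 w' L' (s * f)%g.
  by move=> sc; eexists; eexists; apply: (described_core BM lB sc fD).
have c0 : M.-2 \in core n by rewrite !inE eqxx.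
have c1 : M.-1 \in core n by rewrite !inE eqxx orbT.
have c2 : M \in core n by rewrite !inE eqxx !orbT.
move: sS; rewrite !mem_gen_set /gen_aut !mem_cat => /orP[] /orP[/mapP[p _ sE]|].
- exact: step_case sE.
- rewrite !inE => /or4P[] /eqP sE.
  + by apply: core_case; rewrite sE; apply: core_tperm.
  + by apply: core_case; rewrite sE; apply: core_tperm.
  + by apply: core_case; rewrite sE; apply: core_flip.
  + eexists; eexists; apply: (@described_trans n B BM lw false s w L f lB _ fD).
    by move=> i; rewrite sE trans_autE.
- apply: (step_case p); rewrite -step_permV perm_autV -sE invgK //.
- rewrite !inE => /or4P[] /eqP sE.
  + apply: core_case; rewrite -(invgK s) sE -perm_autV tpermV.
    exact: core_tperm.
  + apply: core_case; rewrite -(invgK s) sE -perm_autV tpermV.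
    exact: core_tperm.
  + by apply: core_case; rewrite -(invgK s) sE flip_autV; apply: core_flip.
  + eexists; eexists; apply: (@described_trans n B BM lw true s w L f lB _ fD).
    by move=> i; rewrite -(invgK s) sE trans_autVE.
Qed.

Lemma described_word ws : is_word (gen_set n) ws -> size ws <= B ->
  exists w L, described B (size ws) w L (\prod_(s <- ws) s)%g.
Proof.
elim: ws => [|s ws IH] /=.
  by move=> _ _; rewrite big_nil; do 2 eexists; apply: described1.
case/andP=> sS /IH{}IH lB; rewrite big_cons.
have [w [L D]] := IH (ltnW lB).
exact: (described_cons lB sS D).
Qed.

(* A site and the value there: [None] in the neighbourhood of the site [0], and
   [Some c] for the letter of sign [c] in the neighbourhood of [M]. *)
Notation entry := ('I_(2 * B).+3 * 'I_(2 * B).+3 * option bool)%type.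

Definition entry_pos (x : entry) : 'I_N :=
  if x.2 is Some _ then site n (M - (B + 2) + x.1.1) else site n x.1.1.

Definition entry_val (x : entry) : free_group N :=
  if x.2 is Some c then fg_letter (site n (M - (B + 2) + x.1.2), c)
  else end_value B (site n x.1.1) x.1.2.

(** Sites without an entry keep their generator; for the tables used below, all entries at one site
    agree. *)
Definition lookup K (es : K.-tuple entry) i : free_group N :=
  if [pick x : entry | (x \in es) && (entry_pos x == i)] is Some x
  then entry_val x else fg_gen i.

(** Sites of the inverted orbits receive an entry even when their generator is unchanged: exponent
    zero, or the letter itself. *)
Lemma local_entry lw w i u : lw <= B -> size w <= lw ->
  local_value B lw w i u ->
  (i : nat) \in prefix_points k 0 w \/ (i : nat) \in central_points n w ->
  exists x, entry_pos x = i /\ entry_val x = u.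
Proof.
move=> lB wl; have wB := leq_trans wl lB.
have end_case e : (i : nat) \in prefix_points k 0 w -> e <= 2 * B ->
    exists x, entry_pos x = i /\ entry_val x = end_value B i e.
  move=> /prefix_points_le iw eB.
  exists (inord i, inord e, None);
    rewrite /entry_pos /entry_val /= !inordK ?site_val //; lia.
have central_case (j : 'I_N) c : (i : nat) \in central_points n w ->
    (j : nat) \in central_points n w ->
    exists x, entry_pos x = i /\ entry_val x = fg_letter (j, c).
  move=> /(central_points_bound BM wB) iw /(central_points_bound BM wB) jw.
  exists (inord (i - (M - (B + 2))), inord (j - (M - (B + 2))), Some c).
  rewrite /entry_pos /entry_val /= !inordK; try lia.
  by rewrite !subnKC ?site_val //; lia.
case=> [->|e iw e1 e2 ->|[j c] iw jw ->] hi.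
- case: hi => [i0|ic].
    have BB : B <= 2 * B by lia.
    by have := end_case B i0 BB; rewrite /end_value mulVg mulg1.
  exact: (central_case i false ic ic).
- by apply: end_case => //; lia.
- exact: central_case.
Qed.

Lemma described_code K lw w L f (t : seq nat) : lw <= B ->
  described B lw w L f -> 3 * size t <= K ->
  {subset prefix_points k 0 w <= t} ->
  {subset prefix_points k (act_a k 0) w <= t} ->
  exists es : K.-tuple entry, forall i, lookup es i = L i.
Proof.
move=> lB [wl fL Lv] tK t0 t1.
pose active i := ((i : nat) \in prefix_points k 0 w) || ((i : nat) \in
  central_points n w).
have ex i : exists x, active i -> entry_pos x = i /\ entry_val x = L i.
  have [ai|_] := boolP (active i); last by exists (ord0, ord0, None).
  by have [x xP] := local_entry lB wl (Lv i) (orP ai); exists x.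
have [ent entP] := choice ex.
(* The three copies of [t] cover the neighbourhood of [0] and the central points on the left and on
   the right. *)
pose pos := t ++ [seq M.-1 - x | x <- t] ++ [seq M + x | x <- t].
have sub i : active i -> (i : nat) \in pos.
  rewrite /pos !mem_cat => /orP[/t0 -> //|].
  rewrite mem_cat => /orP[] /mapP[y yw ->].
    rewrite map_f ?orbT //; move: yw; rewrite mem_cat => /orP[];
      [exact: t0|exact: t1].
  by rewrite [X in _ || (_ || X)]map_f ?orbT //; apply: t0.
pose s0 := [seq i : 'I_N <- pmap insub pos | active i].
have mem_s0 i : (i \in s0) = active i.
  rewrite mem_filter andb_idr // => /sub ip.
  by rewrite mem_pmap; apply/mapP; exists (i : nat) => //; rewrite valK.
have s0K : size s0 <= K.
  apply: leq_trans tK; rewrite size_filter (leq_trans (count_size _ _)) //.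
  rewrite size_pmap (leq_trans (count_size _ _)) // !size_cat !size_map; lia.
(* Site [0] is always active, so its entry can pad the table. *)
have a0 : active (site n 0).
  by rewrite /active siteE ?expn_gt0 // mem_prefix_points.
have szes : size (map ent s0 ++ nseq (K - size s0) (ent (site n 0))) == K.
  by rewrite size_cat size_map size_nseq subnKC.
exists (Tuple szes) => i; rewrite /lookup; case: pickP => [x|none].
  case/andP=> xes /eqP <-.
  have [j [aj ->]] : exists j, active j /\ x = ent j.
    move: xes; rewrite [_ \in _]mem_cat => /orP[/mapP[j]|].
      by rewrite mem_s0 => aj ->; exists j.
    by rewrite mem_nseq => /andP[_ /eqP ->]; exists (site n 0).
  by have [-> ->] := entP _ aj.
have ni : ~~ active i.
  apply/negP => ai; have /negP := none (ent i); apply.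
  have [-> _] := entP _ ai; rewrite eqxx andbT [_ \in _]mem_cat.
  by rewrite map_f // mem_s0.
case: (Lv i) => // [e iw|x iw]; by rewrite /active iw ?orbT in ni.
Qed.

(** The first factor counts codes of trees of sections for the permutation, the second counts tables
    of local values; together they determine the automorphism. *)
Lemma growth_bound r0 Lv :
  (forall w, size w <= B ->
     leaves r0 k (normal_form w).1 (normal_form w).2 <= Lv) ->
  (forall w, size w <= B ->
     leaves r0 k (normal_form (interleave w)).1 (normal_form (interleave w)).2
       <= Lv) ->
  growth (gen_set n) B <=
    #|{: klein * r0.-bseq klein + bool}| ^ (2 * Lv) *
    (3 * (2 * B).+3 ^ 2) ^ (3 * (r0.+1 * Lv)).
Proof.
move=> h1 h2; set K := 3 * (r0.+1 * Lv).
pose C : finType :=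
  ((2 * Lv).-tuple (klein * r0.-bseq klein + bool) * K.-tuple entry)%type.
have -> : #|{: klein * r0.-bseq klein + bool}| ^ (2 * Lv) *
    (3 * (2 * B).+3 ^ 2) ^ K = #|C|.
  rewrite card_prod !card_tuple !card_prod !card_ord card_option card_bool.
  by congr (_ * _ ^ _); rewrite mulnC mulnn.
pose P (f : aut (free_group N)) (c : C) :=
  forall i, f (fg_gen i) = lookup c.2 (site n ((decode_act k c.1).1 i)).
apply: (@growth_le_card _ _ _ C P) => [g [ws [wsS wsB ->]]|f g c fc gc].
  have [w [L D]] := described_word wsS wsB.
  have [wl fL _] := D; have wB := leq_trans wl wsB.
  have [t st [t0 t1]] := prefix_points_cover r0 k w.
  have tK : 3 * size t <= K.
    rewrite leq_pmul2l // (leq_trans st) // leq_pmul2l //; exact: h2.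
  have [es esP] := described_code wsB D tK t0 t1.
  have [c cP] := decode_tuple (h1 _ wB).
  by exists (c, es) => i; rewrite fL esP /= cP gact_normal_form.
by apply: autE_gen => i; rewrite fc gc.
Qed.

End Counting.

(** * Growth *)

Local Open Scope classical_set_scope.
Local Open Scope ring_scope.

Section Eta.
Variable R : realType.

Lemma etaP : eta R ^+ 3 + eta R ^+ 2 + eta R = 2.
Proof.
have : root (eta_poly R) (eta R) by rewrite root_eta_poly.
by rewrite /root eta_polyE subr_eq0 => /eqP.
Qed.

Lemma eta_gt0 : 0 < eta R.
Proof.
rewrite ltNge; apply/negP => e0; have := etaP.
have : eta R * (eta R ^+ 2 + eta R + 1) <= 0.
  rewrite mulr_le0_ge0 //.
  have -> : eta R ^+ 2 + eta R + 1 = (eta R + 1 / 2) ^+ 2 + 3 / 4 by field.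
  by have := sqr_ge0 (eta R + 1 / 2); lra.
have -> : eta R * (eta R ^+ 2 + eta R + 1) =
  eta R ^+ 3 + eta R ^+ 2 + eta R by ring.
lra.
Qed.

Lemma eta_lt1 : eta R < 1.
Proof.
rewrite ltNge; apply/negP => e1; have := etaP.
have := exprn_ege1 3 e1; have := exprn_ege1 2 e1; lra.
Qed.

Lemma ln_2eta_gt0 : 0 < ln (2 / eta R).
Proof.
rewrite ln_gt0 // ltr_pdivlMr ?eta_gt0 //; have := eta_lt1; lra.
Qed.

Lemma alpha0_gt0 : 0 < alpha0 R.
Proof. by rewrite divr_gt0 ?ln_2eta_gt0 // ln_gt0 // ltr1n. Qed.

(** After taking logarithms, [alpha0 R] is the exponent of equality, and the left side decreases
    with [a]. *)
Lemma alpha0_contraction (a : R) : alpha0 R < a -> 2 * (eta R / 2) `^ a < 1.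
Proof.
rewrite ltr_pdivrMr ?ln_2eta_gt0 // => ha.
have e2 : 0 < eta R / 2 by rewrite divr_gt0 // eta_gt0.
have e2V : eta R / 2 = (2 / eta R)^-1 by rewrite invf_div.
rewrite -ltr_ln ?posrE ?mulr_gt0 ?powR_gt0 // ln1 lnM ?posrE ?powR_gt0 //.
rewrite ln_powR e2V lnV ?posrE ?divr_gt0 ?eta_gt0 //; lra.
Qed.

End Eta.

Lemma growth0 (G : groupType) (S : {fset G}) : (growth S 0 <= 1)%N.
Proof.
rewrite -card_unit; apply: (@growth_le_card _ _ _ unit (fun g _ => g = 1%g)).
  move=> g [w [_ w0 ->]]; exists tt; move: w0;
    rewrite leqn0 size_eq0 => /eqP ->.
  by rewrite big_nil.
by move=> g h _ -> ->.
Qed.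

Lemma growth_gen_set (R : realType) (alpha : R) : alpha0 R < alpha < 1 ->
  exists2 C : R, 0 < C & forall n l : nat, (3 * l + 2 <= 2 ^ n)%N ->
    (growth (gen_set n) l)%:R <= expR (C * l%:R `^ alpha).
Proof.
(* An exponent below [alpha] leaves the power [delta] of [B] to absorb the logarithm of the number
   of table entries. *)
move=> /andP[ha ha1]; pose a := (alpha0 R + alpha) / 2.
have a0 := alpha0_gt0 R.
have a_gt : alpha0 R < a by rewrite /a; lra.
have a_lt : a < alpha by rewrite /a; lra.
clearbody a.
have age0 : 0 <= a := ltW (lt_trans a0 a_gt).
have [r0 r0P] := leaves_bound (eta_gt0 R) (eta_lt1 R) (etaP R)
  (lt_trans a0 a_gt) (lt_trans a_lt ha1) (alpha0_contraction a_gt).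
pose Q := #|{: klein * r0.-bseq klein + bool}|.
have Q0 : (0 < Q)%N by apply/card_gt0P; exists (inr false).
pose delta := alpha - a; have d0 : 0 < delta by rewrite subr_gt0.
(* From [T <= 75 * B ^ 2], where [75 = 3 * 5 ^ 2], and from the bound of [ln B] by the power [delta]
   of [B] divided by [delta]. *)
pose c : R := 2 * ln Q%:R + (3 * r0.+1)%:R * (ln 75%:R + 2 / delta).
have c0 : 0 < c.
  rewrite ltr_wpDl // ?mulr_ge0 ?ln_ge0 ?ler1n // mulr_gt0 //.
  by rewrite addr_gt0 ?divr_gt0 // ln_gt0 // ltr1n.
exists (5 `^ a * c); first by rewrite mulr_gt0 // powR_gt0.
move=> n [|l] hl.
  (* For [l = 0] the bound is [1], since [0] to a positive power is [0]. *)
  rewrite powR0; last by rewrite gt_eqF //; lra.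
  by rewrite mulr0 expR0 (_ : 1 = 1%:R) // ler_nat growth0.
have B53 : ((2 * l.+1).+3 <= 5 * l.+1)%N by lia.
have B52 : (3 * l.+1 + 2 <= 5 * l.+1)%N by lia.
set B := l.+1 in B53 B52 *.
have BM : (B + 3 < 2 ^ n.+1)%N by rewrite expnS /B; move: hl; lia.
(* An interleaved word has length at most [3 * B + 1]; one more comes from the shift in
   [leaves_bound]. *)
pose Lv := Num.truncn ((3 * B + 2)%:R `^ a : R).
have leaves_le w : (size w <= (3 * B).+1)%N ->
    (leaves r0 n.+1 (normal_form w).1 (normal_form w).2 <= Lv)%N.
  move=> wB; rewrite truncn_ge_nat ?powR_ge0 //.
  apply: le_trans (r0P _ _ _) _.
  have g0 : 0 <= gweight (eta R) (normal_form w).1 (normal_form w).2.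
    apply: le_trans (gweight_ge (eta_gt0 R) (eta_lt1 R) _ _).
    by rewrite mulr_ge0 // subr_ge0 ltW // eta_cube_lt1 ?eta_gt0 ?eta_lt1.
  apply: ge0_ler_powR; rewrite ?nnegrE ?ler0n ?(addr_ge0 g0 ler01) //.
  have -> : (3 * B + 2)%:R = (3 * B).+1%:R + 1 :> R by rewrite natr1 addn2.
  rewrite lerD2r; apply: le_trans (gweight_normal_form _ (eta_gt0 R) (eta_lt1
    R) (etaP R)) _.
  by rewrite ler_nat.
have := @growth_bound n B BM r0 Lv _ _.
rewrite -(ler_nat R) -/Q => gb.
apply: le_trans (gb _ _) _.
- by move=> w wB; apply: leaves_le; lia.
- by move=> w wB; apply: leaves_le; rewrite size_interleave; lia.
have l1 : 1 <= B%:R :> R by rewrite ler1n.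
have l0 : 0 < B%:R :> R by rewrite ltr0n.
have q0 : 0 < Q%:R :> R by rewrite ltr0n.
set T := (3 * (2 * B).+3 ^ 2)%N.
have T0 : (0 < T)%N by rewrite /T muln_gt0 expn_gt0.
have t0 : 0 < T%:R :> R by rewrite ltr0n.
have -> : (Q ^ (2 * Lv) * T ^ (3 * (r0.+1 * Lv)))%:R =
    expR (Lv%:R * (2 * ln Q%:R + (3 * r0.+1)%:R * ln T%:R)) :> R.
  rewrite natrM !natrX -[Q%:R in LHS]lnK ?posrE // -[T%:R in LHS]lnK ?posrE //.
  rewrite -!expRM_natl -expRD; congr expR; rewrite !natrM; ring.
rewrite ler_expR.
have lnB : ln B%:R <= B%:R `^ delta / delta.
  rewrite ler_pdivlMr // mulrC -ln_powR ltW // ln_sublinear // powR_gt0 //.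
have B1 : 1 <= B%:R `^ delta.
  by have := ler_powR l1 (ltW d0); rewrite powRr0.
have lnT : ln T%:R <= (ln 75%:R + 2 / delta) * B%:R `^ delta.
  apply: (@le_trans _ _ (ln (75%:R * B%:R ^+ 2))).
    rewrite ler_ln ?posrE ?mulr_gt0 ?exprn_gt0 //.
    rewrite -natrX -natrM ler_nat /T -[75%N]/(3 * 5 ^ 2)%N -mulnA -expnMn.
    by rewrite leq_mul2l leq_exp2r ?B53.
  rewrite lnM ?posrE ?exprn_gt0 // lnXn // mulrDl lerD //.
    by rewrite ler_peMr // ln_ge0 // ler1n.
  by rewrite -[leLHS]mulr_natl -mulrA [_^-1 * _]mulrC ler_pM2l.
have cB : 2 * ln Q%:R + (3 * r0.+1)%:R * ln T%:R <= c * B%:R `^ delta.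
  rewrite /c [leRHS]mulrDl lerD //.
    by rewrite ler_peMr // mulr_ge0 // ln_ge0 // ler1n.
  by rewrite -mulrA ler_wpM2l.
have B52R : (3 * B + 2)%:R <= 5%:R * B%:R :> R by rewrite -natrM ler_nat.
have LvB : Lv%:R <= 5 `^ a * B%:R `^ a.
  rewrite -powRM //; apply: (@le_trans _ _ ((3 * B + 2)%:R `^ a)).
    by rewrite truncn_le powR_ge0.
  apply: ge0_ler_powR; rewrite ?nnegrE ?ler0n ?mulr_ge0 //.
have -> : 5 `^ a * c * B%:R `^ alpha = 5 `^ a * B%:R `^ a * (c * B%:R `^ delta).
  have -> : alpha = a + delta by rewrite /delta addrC subrK.
  rewrite powRD; last by rewrite (gt_eqF l0) implybT.
  by ring.
apply: ler_pM => //.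
by rewrite addr_ge0 ?mulr_ge0 ?ln_ge0 ?ler1n.
Qed.

(** * Submultiplicativity and the growth rate *)

Section Fekete.
Variables (G : groupType) (S : {fset G}).

Lemma growth_gt0 l : (0 < growth S l)%N.
Proof.
rewrite /growth cardfs_gt0; apply/fset0Pn; exists 1%g.
rewrite in_fset_set; last exact: finite_word_ball.
by rewrite inE; exists [::]; rewrite big_nil.
Qed.

Lemma growth_mono : {homo growth S : i j / (i <= j)%N}.
Proof.
move=> i j ij; rewrite /growth fsubset_leq_card //.
rewrite -fset_set_sub; try exact: finite_word_ball.
by move=> g [w [Sw wi ->]]; exists w; split=> //; apply: leq_trans ij.
Qed.

Lemma growthD i j : (growth S (i + j) <= growth S i * growth S j)%N.
Proof.
have inB l g : word_ball S l g -> g \in fset_set (word_ball S l).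
  by move=> gl; rewrite in_fset_set ?inE //; apply: finite_word_ball.
pose C : finType := (fset_set (word_ball S i) * fset_set (word_ball S j))%type.
have -> : (growth S i * growth S j)%N =
  #|C| by rewrite card_prod /growth !cardfE.
apply: (@growth_le_card _ _ _ C (fun g c => g = val c.1 * val c.2)%g).
  move=> g [w [Sw wij ->]].
  have hu : word_ball S i (\prod_(s <- take i w) s)%g.
    exists (take i w); split=> //; last by rewrite size_take; case: ifP; lia.
    by move: Sw; rewrite /is_word -{1}(cat_take_drop i w) all_cat => /andP[].
  have hv : word_ball S j (\prod_(s <- drop i w) s)%g.
    exists (drop i w); split=> //; last by rewrite size_drop; lia.
    by move: Sw; rewrite /is_word -{1}(cat_take_drop i w) all_cat => /andP[].
  exists ([` inB _ _ hu]%fset, [` inB _ _ hv]%fset) => /=.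
  by rewrite -big_cat cat_take_drop.
by move=> g h c -> ->.
Qed.

Lemma growthM q i : (growth S (q * i) <= growth S i ^ q)%N.
Proof.
elim: q => [|q IH]; first exact: growth0.
by rewrite mulSn expnS (leq_trans (growthD _ _)) // leq_mul.
Qed.

Variable R : realType.

Let a (l : nat) : R := ln (growth S l)%:R / l%:R.

Lemma ln_growth_ge0 l : 0 <= ln (growth S l)%:R :> R.
Proof. by rewrite ln_ge0 // ler1n growth_gt0. Qed.

(** Submultiplicativity, with [l] rounded up to a multiple of [m]. *)
Lemma log_growth_le m l : (0 < m)%N -> (0 < l)%N ->
  a l <= a m + ln (growth S m)%:R / l%:R.
Proof.
move=> m0 l0.
have gl : (growth S l <= growth S m ^ (l %/ m).+1)%N.
  apply: leq_trans (growthM _ _); apply: growth_mono.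
  by rewrite mulSn addnC ltnW // {1}(divn_eq l m) ltn_add2l ltn_mod.
have u0 i : 0 < (growth S i)%:R :> R by rewrite ltr0n growth_gt0.
have : ln (growth S l)%:R <= (l %/ m).+1%:R * ln (growth S m)%:R :> R.
  rewrite mulr_natl -lnXn // ler_ln ?posrE ?exprn_gt0 //.
  by rewrite -natrX ler_nat.
have lR : 0 < l%:R :> R by rewrite ltr0n.
have mR : 0 < m%:R :> R by rewrite ltr0n.
move=> h; rewrite /a ler_pdivrMr //; apply: le_trans h _.
rewrite mulrDl mulfVK ?gt_eqF // -natr1 mulrDl mul1r lerD2r.
rewrite mulrC -mulrA ler_wpM2l ?ln_growth_ge0 // mulrC ler_pdivlMr //.
by rewrite -natrM ler_nat leq_trunc_div.
Qed.

(** Fekete's lemma: [a] converges to its infimum, as [log_growth_le] bounds it by any [a m] up to an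
    error of order [1 / l]. *)
Lemma growth_rate_cvg : exists2 b : R,
  ((growth S l)%:R `^ (l%:R^-1) @[l --> \oo] --> expR b)%classic &
  forall l, (0 < l)%N -> b <= a l.
Proof.
pose E := [set a l | l in [set l | (0 < l)%N]]%classic.
have Elb : lbound E 0.
  by move=> _ [l _ <-]; rewrite /a divr_ge0 ?ln_growth_ge0.
have infE : has_inf E by split; [exists (a 1%N); exists 1%N | exists 0].
exists (inf E); last by move=> l l0; apply: ge_inf; [exists 0|exists l].
have aE : \forall l \near \oo, expR (a l) = (growth S l)%:R `^ (l%:R^-1).
  near=> l; rewrite -[X in X `^ _]lnK ?posrE ?ltr0n ?growth_gt0 //.
  by rewrite -expRM.
apply: cvg_trans (near_eq_cvg aE) _.
suff aL : a l @[l --> \oo] --> inf E.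
  exact: (cvg_comp _ _ aL (@continuous_expR R (inf E))).
apply/cvgrPdist_le => eps eps0.
have [_ [m /= m0 <-] am] := inf_adherent (divr_gt0 eps0 (ltr0Sn R 1)) infE.
near=> l.
have l0 : (0 < l)%N by near: l; exists 1%N.
have h1 : inf E <= a l by apply: ge_inf; [exists 0|exists l].
have h2 := log_growth_le m0 l0.
have h3 : ln (growth S m)%:R / l%:R <= eps / 2.
  rewrite ler_pdivrMr ?ltr0n // mulrC -ler_pdivrMr ?divr_gt0 //.
  near: l; exact: nbhs_infty_ger.
by rewrite ler0_norm; lra.
Unshelve. all: by end_near. Qed.

Lemma growth_rate_le l : (0 < l)%N -> growth_rate R S <= expR (a l).
Proof.
move=> l0; have [b cb bl] := growth_rate_cvg.
rewrite /growth_rate (cvg_lim _ cb) ?ler_expR ?bl //; exact: Rhausdorff.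
Qed.

End Fekete.

Theorem theorem3 (R : realType) :
  (exists A : forall n : nat, {fset aut (free_group (2 ^ (n + 2)))},
     (forall n : nat, generates (A n)) /\
     (forall alpha : R, alpha0 R < alpha < 1 ->
        exists2 C : R, 0 < C &
          forall n l : nat, l%:R <= (2 ^+ n - 2) / 3 :> R ->
            (growth (A n) l)%:R <= expR (C * l%:R `^ alpha))) /\
  (forall beta : R, 0 < beta < 1 - alpha0 R ->
     \forall n \near \oo,
       (min_growth_rate R (aut (free_group (2 ^ (n + 2))))
          <= (expR (2 `^ (- (beta * (n + 2)%:R))))%:E)%E).
Proof.
split.
  exists gen_set; split; first exact: gen_set_generates.
  move=> alpha /growth_gen_set[C C0 CP]; exists C => // n l ln.
  apply: CP; rewrite -(ler_nat R) natrD natrM natrX.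
  by move: ln; rewrite ler_pdivlMr //; lra.
move=> beta /andP[b0 b1].
(* The midpoint between [alpha0 R] and [1 - beta], so that [1 - alpha] still exceeds [beta]. *)
pose alpha := (alpha0 R + (1 - beta)) / 2.
have ha : alpha0 R < alpha < 1 by rewrite /alpha; lra.
have ab : 0 < 1 - alpha - beta by rewrite /alpha; lra.
have [C C0 CP] := growth_gen_set ha.
have ln2 : 0 < ln 2 :> R by rewrite ln_gt0 // ltr1n.
near=> n.
have n3 : (3 <= n)%N by near: n; exists 3%N.
(* A quarter of [2 ^ n]: then [3 * l + 2 <= 4 * l] as soon as [l >= 2]. *)
set l := (2 ^ (n - 2))%N.
have l0 : (0 < l)%N by rewrite expn_gt0.
have nl : (3 * l + 2 <= 2 ^ n)%N.
  have -> : (2 ^ n = 4 * l)%N.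
    by rewrite /l -[4%N]/(2 ^ 2)%N -expnD subnKC // ltnW.
  have : (2 <= l)%N.
    by rewrite -[2%N]/(2 ^ 1)%N leq_exp2l // ltn_subRL.
  by move: (l) => l'; lia.
apply: (@le_trans _ _ (growth_rate R (gen_set n))%:E).
  by apply: ereal_inf_lbound; exists (gen_set n) => //;
    apply: gen_set_generates.
rewrite lee_fin; apply: le_trans (growth_rate_le (gen_set n) R l0) _.
rewrite ler_expR.
have lR : 0 < l%:R :> R by rewrite ltr0n.
apply: (@le_trans _ _ (C * l%:R `^ (alpha - 1))).
  rewrite ler_pdivrMr // -mulrA -[X in _ * (_ * X)]powRr1 ?ler0n //.
  rewrite -powRD; last by rewrite (gt_eqF lR) implybT.
  rewrite subrK -ler_expR lnK ?posrE ?ltr0n ?growth_gt0 //.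
  exact: CP.
have lE : l%:R = expR ((n%:R - 2) * ln 2) :> R.
  rewrite /l natrX -[X in X ^+ _]lnK ?posrE // -expRM_natl natrB ?(ltnW n3) //.
have -> : l%:R `^ (alpha - 1) = expR ((alpha - 1) * ((n%:R - 2) * ln 2)).
  by rewrite lE -expRM mulrC.
have -> : 2 `^ (- (beta * (n + 2)%:R)) =
  expR (- (beta * (n%:R + 2)) * ln 2) :> R.
  by rewrite -[X in X `^ _]lnK ?posrE // -expRM mulrC natrD.
rewrite -[C]lnK ?posrE // -expRD ler_expR.
(* The comparison of the two exponents, linear in [n], solved for [n]. *)
have : (ln C + ln 2 * (2 * (1 - alpha) + 2 * beta)) / (ln 2 * (1 - alpha -
  beta)) <= n%:R.
  by near: n; exact: nbhs_infty_ger.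
rewrite ler_pdivrMr ?mulr_gt0 // => h.
rewrite -subr_ge0; move: h; rewrite -subr_ge0.
set x := _ - _; set y := _ - _; have -> : x = y by rewrite /x /y; ring.
by [].
Unshelve. all: by end_near. Qed.
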